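(* There is a polynomial-time algorithm that, given a general matroid $M=(V,\mathcal{I})$ (accessed through an independence oracle) and a graph $G=(V,E)$ on the ground set of $M$ with maximum degree at most $\Delta$, produces a coloring of $G\cap M$ using at most $\Delta+\chi(M)+1$ colors.
   Context: Let $\mathcal{J}$ be the family of independent (stable) sets of $G$, i.e. sets of vertices no two of which are adjacent. $G\cap M$ denotes the set system $(V,\mathcal{J}\cap\mathcal{I})$. A coloring of $G\cap M$ assigns a color to every vertex so that each color class is both a stable set of $G$ and independent in $M$. $\chi(M)$ is the minimum number of colors in a coloring of $V$ whose color classes are independent in $M$. *)

(* Defs.v *)
From HB Require Import structures.
From mathcomp Require Import all_boot all_order all_algebra.

Set Implicit Arguments.
Unset Strict Implicit.
Unset Printing Implicit Defensive.

Record matroid (V : finType) := Matroid {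
  indep : pred {set V};
  indep0 : indep set0;
  indep_sub : forall A B : {set V}, A \subset B -> indep B -> indep A;
  indep_aug : forall A B : {set V}, indep A -> indep B -> #|A| < #|B| ->
    exists2 x, x \in B :\: A & indep (x |: A)
}.

Record sgraph (V : finType) := SGraph {
  adj : rel V;
  adj_sym : symmetric adj;
  adj_irr : irreflexive adj
}.

Definition stable (V : finType) (G : sgraph V) : pred {set V} :=
  fun S => [forall u in S, forall v in S, ~~ adj G u v].

Definition degree (V : finType) (G : sgraph V) (v : V) : nat :=
  #|[set u | adj G v u]|.

Definition max_degree (V : finType) (G : sgraph V) : nat :=
  \max_(v : V) degree G v.

Definition graph_cap_matroid (V : finType) (G : sgraph V) (M : matroid V) :
    pred {set V} :=
  fun S => stable G S && indep M S.

(* Colorings of a set system (V, F).  The set systems used here contain set0,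
   so quantifying over unused colors as well is harmless. *)
Definition coloring (V : finType) (F : pred {set V}) (C : eqType)
    (f : V -> C) : Prop :=
  forall c : C, F [set v | f v == c].

Definition num_colors (V : finType) (C : eqType) (f : V -> C) : nat :=
  size (undup [seq f v | v <- enum V]).

Definition colorable (V : finType) (F : pred {set V}) (k : nat) : bool :=
  [exists f : {ffun V -> 'I_k}, [forall c, F [set v | f v == c]]].

(* The chromatic number of a set system is defined only when some coloring
   exists; for a matroid this means that it has no loop. *)
Definition chi (V : finType) (F : pred {set V})
    (colF : exists k, colorable F k) : nat :=
  ex_minn colF.

(* Model of computation: a random access machine over the natural numbers,
   presented as a structured language.  A program uses finitely many scalar
   variables and two-dimensional arrays, addressed by numerical names.  The
   arithmetic operations are addition, truncated subtraction and comparison;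
   multiplication is left out on purpose: values then have O(t) more bits than
   the input after t steps, so that the unit-cost measure is polynomially
   related to Turing machine time. *)
Inductive expr :=
| EConst of nat
| EVar of nat
| EGet of nat & expr & expr
| EAdd of expr & expr
| ESub of expr & expr
| EEq of expr & expr
| ELt of expr & expr.

Inductive cmd :=
| CSkip
| CAssign of nat & expr
| CPut of nat & expr & expr & expr
| CQuery of nat & nat & expr
| CSeq of cmd & cmd
| CIf of expr & cmd & cmd
| CWhile of expr & cmd.

Record state := State {
  scalar : nat -> nat;
  array : nat -> nat -> nat -> nat
}.

Definition set_scalar (s : state) (x k : nat) : state :=
  State (fun y => if y == x then k else scalar s y) (array s).

Definition set_array (s : state) (a i j k : nat) : state :=
  State (scalar s)
    (fun b i' j' => if [&& b == a, i' == i & j' == j] then k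
                    else array s b i' j').

Fixpoint eval (s : state) (e : expr) : nat :=
  match e with
  | EConst k => k
  | EVar x => scalar s x
  | EGet a e1 e2 => array s a (eval s e1) (eval s e2)
  | EAdd e1 e2 => eval s e1 + eval s e2
  | ESub e1 e2 => eval s e1 - eval s e2
  | EEq e1 e2 => eval s e1 == eval s e2
  | ELt e1 e2 => eval s e1 < eval s e2
  end.

(* The machine knows an element v of the ground set as the number
   enum_rank v < #|V|; row i of array a denotes a subset of V. *)
Definition row_set (V : finType) (s : state) (a i : nat) : {set V} :=
  [set v | array s a i (enum_rank v) != 0].

(* [exec O c s t s'] : with oracle O, the program c started in state s halts
   after t steps in state s'.  An expression is loop-free, so its evaluation
   takes time bounded by a constant of the program and is counted as one step.
   [CQuery x a e] stores in x the oracle's answer on the set given by row e of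
   array a, and is charged #|V| + 1 steps, the length of the query. *)
Inductive exec (V : finType) (O : pred {set V}) :
    cmd -> state -> nat -> state -> Prop :=
| ExecSkip s : exec O CSkip s 1 s
| ExecAssign s x e : exec O (CAssign x e) s 1 (set_scalar s x (eval s e))
| ExecPut s a e1 e2 e :
    exec O (CPut a e1 e2 e) s 1
      (set_array s a (eval s e1) (eval s e2) (eval s e))
| ExecQuery s x a e :
    exec O (CQuery x a e) s #|V|.+1
      (set_scalar s x (O (row_set V s a (eval s e))))
| ExecSeq c1 c2 s1 s2 s3 t1 t2 :
    exec O c1 s1 t1 s2 -> exec O c2 s2 t2 s3 ->
    exec O (CSeq c1 c2) s1 (t1 + t2) s3
| ExecIfTrue e c1 c2 s s' t :
    eval s e != 0 -> exec O c1 s t s' -> exec O (CIf e c1 c2) s t.+1 s'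
| ExecIfFalse e c1 c2 s s' t :
    eval s e = 0 -> exec O c2 s t s' -> exec O (CIf e c1 c2) s t.+1 s'
| ExecWhileFalse e c s : eval s e = 0 -> exec O (CWhile e c) s 1 s
| ExecWhileTrue e c s1 s2 s3 t1 t2 :
    eval s1 e != 0 -> exec O c s1 t1 s2 -> exec O (CWhile e c) s2 t2 s3 ->
    exec O (CWhile e c) s1 (t1 + t2).+1 s3.

(* Input convention: scalar 0 holds #|V|, array 0 holds the adjacency matrix,
   everything else is 0. *)
Definition input (V : finType) (G : sgraph V) : state :=
  State
    (fun x => if x == 0 then #|V| else 0)
    (fun a i j =>
       [&& a == 0 & [exists u : V, exists v : V,
          [&& enum_rank u == i :> nat, enum_rank v == j :> nat & adj G u v]]]).

(* Output convention: the color of v is read in column 0 of array 1. *)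
Definition output (V : finType) (s : state) : V -> nat :=
  fun v => array s 1 (enum_rank v) 0.

(* Main.v *)
(* In fact Delta + chi(M) colors suffice. Start from a partition J_1, ..., J_r
   of the ground set into r <= chi(M) independent sets (loops are set aside),
   found by augmenting paths. Each new color class is a stable independent set I
   built in r stages: writing U_c for the members of J_c blocked by a neighbor
   in I, with I u U_c independent, Greene's multiple exchange splits J_(c+1) as
   P u Q with I u P and U_c u Q independent; then P is added greedily to I, the
   members of P blocked by I form U_(c+1), and U_c u Q is the new J_c. So in
   every round each remaining vertex either moves down one class or loses a
   remaining neighbor, and its class index plus its remaining degree, initially
   at most r + Delta, decreases.
   Augmentation needs no bookkeeping of paths: moving the nearest vertex that
   can enter a class freely brings such a vertex one step closer to the root. *)
From mathcomp Require Import all_boot all_order all_algebra zify.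
(* Imported last: the [scalar] of all_algebra would hide that of [state]. *)
Require Import Defs.

(** The partition and Greene's exchange are solved by one procedure: insert a vertex x into a
    partial coloring by independent classes, where each vertex may only use the classes on its list.
    For the partition every list consists of the current classes. For the exchange the vertices of
    J_(c+1) may use the classes of I and U_c, and every other placed vertex is confined to its own
    class. When an insertion fails, the vertices reachable from x form a set R such that no
    independent subset of R whose members all admit a class d is larger than the part of d in R.
    Since x has no class, counting inside R refutes the failure.

    All loops run |V| + k times with k constant, so termination and a polynomial bound are read off
    the syntax. As Delta and r are at most |V|, 2|V| rounds are enough. A vertex still present has
    class index at least 1, so the potential also bounds the number of the color it receives by
    Delta + r; later rounds use no new color. *)

Set Implicit Arguments.
Unset Strict Implicit.
Unset Printing Implicit Defensive.

(** * Bounded loop programs *)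

(* [For i k p] runs p with scalar i ranging over 0, ..., n + k - 1, where n is
   the value of scalar 0. *)
Inductive prog :=
| Skip
| Assign of nat & expr
| Put of nat & expr & expr & expr
| Query of nat & nat & expr
| Seq of prog & prog
| If of expr & prog & prog
| For of nat & nat & prog.

Fixpoint compile (p : prog) : cmd :=
  match p with
  | Skip => CSkip
  | Assign x e => CAssign x e
  | Put a e1 e2 e => CPut a e1 e2 e
  | Query x a e => CQuery x a e
  | Seq p q => CSeq (compile p) (compile q)
  | If e p q => CIf e (compile p) (compile q)
  | For i k p =>
      CSeq (CAssign i (EConst 0))
        (CWhile (ELt (EVar i) (EAdd (EVar 0) (EConst k)))
           (CSeq (compile p) (CAssign i (EAdd (EVar i) (EConst 1)))))
  end.

Fixpoint mods (p : prog) : seq nat :=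
  match p with
  | Skip | Put _ _ _ _ => [::]
  | Assign x _ | Query x _ _ => [:: x]
  | Seq p q | If _ p q => mods p ++ mods q
  | For i _ p => i :: mods p
  end.

Fixpoint moda (p : prog) : seq nat :=
  match p with
  | Skip | Assign _ _ | Query _ _ _ => [::]
  | Put a _ _ _ => [:: a]
  | Seq p q | If _ p q => moda p ++ moda q
  | For _ _ p => moda p
  end.

(** If the body could overwrite its own counter, the compiled loop might not stop or might skip
    values; with this condition the iteration count is known in advance. *)
Fixpoint wf (p : prog) : bool :=
  match p with
  | Seq p q | If _ p q => wf p && wf q
  | For i _ p => (i \notin mods p) && wf p
  | _ => true
  end.

(** * Functional semantics, frame rules and cost of bounded loop programs *)

Section Run.
Variables (V : finType) (O : pred {set V}).

Fixpoint run (p : prog) (s : state) : state :=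
  match p with
  | Skip => s
  | Assign x e => set_scalar s x (eval s e)
  | Put a e1 e2 e => set_array s a (eval s e1) (eval s e2) (eval s e)
  | Query x a e => set_scalar s x (O (row_set V s a (eval s e)))
  | Seq p q => run q (run p s)
  | If e p q => if eval s e != 0 then run p s else run q s
  | For i k p =>
      foldl (fun s j => set_scalar (run p s) i j.+1) (set_scalar s i 0)
        (iota 0 (scalar s 0 + k))
  end.

Lemma run_seq p q s : run (Seq p q) s = run q (run p s).
Proof. by []. Qed.

Lemma run_put a e1 e2 e s :
  run (Put a e1 e2 e) s = set_array s a (eval s e1) (eval s e2) (eval s e).
Proof. by []. Qed.

Lemma run_assign x e s : run (Assign x e) s = set_scalar s x (eval s e).
Proof. by []. Qed.

Lemma run_if e p q s :
  run (If e p q) s = if eval s e != 0 then run p s else run q s.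
Proof. by []. Qed.

Lemma run_scalar p s x : x \notin mods p -> scalar (run p s) x = scalar s x.
Proof.
elim: p s => //= [y e|y a e|p IHp q IHq|e p IHp q IHq|i k p IHp] s.
- by rewrite inE => /negbTE ->.
- by rewrite inE => /negbTE ->.
- by rewrite mem_cat negb_or => /andP[/IHp xp /IHq xq]; rewrite xq xp.
- by rewrite mem_cat negb_or => /andP[/IHp xp /IHq xq]; case: ifP.
- rewrite inE negb_or => /andP[xi xp];
  have <- : scalar (set_scalar s i 0) x = scalar s x by rewrite /= (negbTE xi).
  move: (set_scalar s i 0) (iota _ _) => {}s l; elim: l s => //= j l IH s.
  by rewrite IH /= (negbTE xi) IHp.
Qed.

Lemma run_array p s a i j :
  a \notin moda p -> array (run p s) a i j = array s a i j.
Proof.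
elim: p s => //= [b e1 e2 e|p IHp q IHq|e p IHp q IHq|x k p IHp] s.
- by rewrite inE => /negbTE ->.
- by rewrite mem_cat negb_or => /andP[/IHp xp /IHq xq]; rewrite xq xp.
- by rewrite mem_cat negb_or => /andP[/IHp xp /IHq xq]; case: ifP.
- move=> ap; rewrite -[RHS]/(array (set_scalar s x 0) a i j).
  move: (set_scalar s x 0) (iota _ _) => {}s l.
  by elim: l s => //= m l IH s; rewrite IH /= IHp.
Qed.

(** The frame conditions are handed to the step, so an invariant only has to describe what the body
    changes. *)
Lemma run_for (Inv : nat -> state -> Prop) i k p s :
  Inv 0 (set_scalar s i 0) ->
  (forall j s1, j < scalar s 0 + k -> scalar s1 i = j ->
     (forall y, y \notin i :: mods p -> scalar s1 y = scalar s y) ->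
     (forall a, a \notin moda p ->
        forall i j, array s1 a i j = array s a i j) ->
     Inv j s1 -> Inv j.+1 (set_scalar (run p s1) i j.+1)) ->
  Inv (scalar s 0 + k) (run (For i k p) s).
Proof.
move=> Inv0 InvS /=; set N := scalar s 0 + k.
suff gen m j s1 : j + m = N -> scalar s1 i = j ->
     (forall y, y \notin i :: mods p -> scalar s1 y = scalar s y) ->
     (forall a, a \notin moda p ->
        forall i j, array s1 a i j = array s a i j) -> Inv j s1 ->
     Inv N (foldl (fun s j => set_scalar (run p s) i j.+1) s1 (iota j m)).
  apply: gen => //; first by rewrite /= eqxx.
  by move=> y; rewrite inE negb_or /= => /andP[/negbTE ->].
elim: m j s1 => [|m IH] j s1; first by rewrite addn0 => <-.
move=> /= jm s1i fs fa Ij; apply: IH => /=.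
- by rewrite -jm addnS.
- by rewrite eqxx.
- move=> y yp; move: (yp); rewrite inE negb_or => /andP[/negbTE -> yp'].
  by rewrite run_scalar ?fs.
- by move=> a ap i' j'; rewrite run_array ?fa.
- by apply: InvS => //; rewrite -/N -jm; lia.
Qed.

(** Both branches of a conditional are charged, which keeps the bound a polynomial. An iteration
    pays for the body, the counter increment and the loop test. *)
Fixpoint cost (p : prog) : {poly nat} :=
  match p with
  | Query _ _ _ => 'X + 1
  | Seq p q => cost p + cost q
  | If _ p q => 1 + cost p + cost q
  | For _ k p => 1 + (('X + k%:P) * (cost p + 1 + 1) + 1)
  | _ => 1
  end%R.

(** Scalar 0 must stay fixed: the compiled loop reads its bound again at every test, whereas [run]
    reads it once. *)
Lemma exec_compile p s :
  wf p -> 0 \notin mods p -> scalar s 0 = #|V| ->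
  exists2 t, t <= (cost p).[#|V|]%R & exec O (compile p) s t (run p s).
Proof.
elim: p s => [|x e|a e1 e2 e|x a e|p IHp q IHq|e p IHp q IHq|i k p IHp] s /=.
- by exists 1; [rewrite hornerE|constructor].
- by exists 1; [rewrite hornerE|constructor].
- by exists 1; [rewrite hornerE|constructor].
- move=> _ _ _; exists #|V|.+1; last by constructor.
  by rewrite !hornerE /= -addn1.
- rewrite mem_cat negb_or => /andP[wp wq] /andP[p0 q0] s0.
  have [t1 t1p e1] := IHp s wp p0 s0.
  have [|t2 t2q e2] := IHq (run p s) wq q0; first by rewrite run_scalar.
  by exists (t1 + t2); [rewrite hornerD leq_add|apply: ExecSeq e1 e2].
- rewrite mem_cat negb_or => /andP[wp wq] /andP[p0 q0] s0.
  have [t1 t1p e1] := IHp s wp p0 s0.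
  have [t2 t2q e2] := IHq s wq q0 s0.
  have -> : (1 + cost p + cost q).[#|V|]%R =
      (1 + (cost p).[#|V|]%R + (cost q).[#|V|]%R)%N by rewrite !hornerE.
  case: ifPn => [se|/negPn/eqP se].
    exists t1.+1; last exact: ExecIfTrue.
    by lia.
  exists t2.+1; last exact: ExecIfFalse.
  by lia.
- move=> /andP[ip wp]; rewrite inE negb_or => /andP[i0 p0] s0.
  set C := (cost p).[#|V|]%R in IHp *.
  set w := CWhile _ _; rewrite s0.
  suff gen m j s1 : j + m = #|V| + k -> scalar s1 i = j -> scalar s1 0 = #|V| ->
      exists2 t, t <= m * (C + 2) + 1 & exec O w s1 t
        (foldl (fun s j => set_scalar (run p s) i j.+1) s1 (iota j m)).
    have [|||t tb et] := gen (#|V| + k) 0 (set_scalar s i 0) => //=.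
    - by rewrite eqxx.
    - by rewrite (negbTE i0).
    - exists (1 + t); last by apply: ExecSeq et; constructor.
      have -> : (1 + (('X + k%:P) * (cost p + 1 + 1) + 1)).[#|V|]%R =
          (1 + ((#|V| + k) * (C + 1 + 1) + 1))%N by rewrite !hornerE.
      by rewrite -(addnA C) leq_add2l.
  elim: m j s1 => [|m IH] j s1 jm s1i s10.
    exists 1 => //=; apply: ExecWhileFalse => /=.
    by rewrite s1i s10 -jm addn0 ltnn.
  have [t1 t1p e1] := IHp s1 wp p0 s10.
  have [||| t2 t2p e2] := IH j.+1 (set_scalar (run p s1) i j.+1) => /=.
  - by rewrite -jm addnS.
  - by rewrite eqxx.
  - by rewrite (negbTE i0) run_scalar.
  exists ((t1 + 1) + t2).+1; first by rewrite mulSn; lia.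
  apply: ExecWhileTrue e2 => /=; first by rewrite s1i s10 -jm; lia.
  apply: ExecSeq e1 _.
  have -> : j.+1 = eval (run p s1) (EAdd (EVar i) (EConst 1)).
    by rewrite /= run_scalar // s1i addn1.
  exact: ExecAssign.
Qed.

End Run.

(** * Augmentation in matroids *)

Section Classes.
Variable V : finType.
Implicit Types (col : V -> nat) (u v w : V) (d k : nat).

Definition cls col d : {set V} := [set v | col v == d].

Definition upd col w k : V -> nat := fun v => if v == w then k else col v.

Lemma cls_upd_new col w d : cls (upd col w d) d = w |: cls col d.
Proof.
by apply/setP=> v; rewrite !inE /upd; case: (v == w); rewrite ?eqxx.
Qed.

Lemma cls_upd_old col w d :
  d != col w -> cls (upd col w d) (col w) = cls col (col w) :\ w.
Proof.
by move=> /negbTE dw; apply/setP=> v; rewrite !inE /upd; case: (v == w);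
  rewrite ?dw.
Qed.

Lemma cls_upd_other col w d k :
  k != d -> k != col w -> cls (upd col w d) k = cls col k.
Proof.
move=> kd kw; apply/setP=> v; rewrite !inE /upd; case: (eqVneq v w) => // ->.
by rewrite ![_ == k]eq_sym (negbTE kd) (negbTE kw).
Qed.

End Classes.

Section Augment.
Variables (V : finType) (M : matroid V).
Implicit Types (A B I K R : {set V}) (u v w y : V) (d k : nat).

Lemma indep_extend A B :
  indep M A -> indep M B ->
  exists K, [/\ A \subset K, K \subset A :|: B, indep M K & #|B| <= #|K|].
Proof.
have [m] := ubnP (#|B| - #|A|); elim: m A => // m IH A Bm iA iB.
have [BA|AB] := leqP #|B| #|A|.
  by exists A; rewrite subxx subsetUl.
have [z] := indep_aug iA iB AB; rewrite inE => /andP[zA zB] izA.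
have [|K [zK KB iK BK]] := IH (z |: A) _ izA iB.
  by rewrite cardsU1 zA; lia.
exists K; split=> //; first by apply: subset_trans zK; apply: subsetUr.
apply: subset_trans KB _; rewrite -setUA subUset subxx andbT sub1set.
by rewrite inE zB orbT.
Qed.

(** The fundamental circuit of y in I has an element of I outside R, since y |: (I :&: R) is
    independent. Extending that set from I leaves out exactly one element of y |: I, which serves as
    u. *)
Lemma indep_swap I R y :
  indep M I -> y \notin I -> indep M (y |: (I :&: R)) -> ~~ indep M (y |: I) ->
  exists u, [/\ u \in I, u \notin R & indep M ((y |: I) :\ u)].
Proof.
move=> iI yI iyR niyI; have [K [sK Ks iK IK]] := indep_extend iyR iI.
have KyI : K \subset y |: I.
  apply: subset_trans Ks _.
  by rewrite -setUA setUS // subUset subxx subsetIl.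
have : ~~ (y |: I \subset K).
  by apply: contra niyI => sK'; apply: indep_sub iK.
case/subsetPn=> u; rewrite in_setU1 => uyI uK.
have uy : u != y.
  by apply: contraNneq uK => ->; apply: (subsetP sK); rewrite setU11.
have uI : u \in I by move: uyI; rewrite (negbTE uy).
exists u; split=> //.
  by apply: contra uK => uR; apply: (subsetP sK); rewrite !inE uI uR orbT.
suff -> : (y |: I) :\ u = K by [].
apply/esym/eqP; rewrite eqEcard subsetD1 KyI uK /=.
have := cardsD1 u (y |: I); rewrite in_setU1 uI orbT cardsU1 yI.
by rewrite !add1n => -[<-].
Qed.

(** The fundamental circuit of y in I does not change when v joins I. Concretely, augmenting the
    exchanged set from v |: I can only add v, since adding u would make y |: I independent. *)
Lemma indep_swapU I u v y :
  u \in I -> v \notin I -> y \notin I -> indep M (v |: I) ->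
  ~~ indep M (y |: I) -> indep M ((y |: I) :\ u) ->
  indep M ((y |: (v |: I)) :\ u).
Proof.
move=> uI vI yI ivI niyI iyIu.
have [|z] := indep_aug iyIu ivI.
  have := cardsD1 u (y |: I); rewrite in_setU1 uI orbT !cardsU1 yI vI !add1n.
  by move=> [<-].
case/setDP=> /setU1P zv zn iz.
have uy : u != y by apply: contraNneq yI => <-.
have uv : u != v by apply: contraNneq vI => <-.
have [zu|zu] := eqVneq z u.
  case/negP: niyI; apply: indep_sub iz; apply/subsetP=> t tyI.
  by rewrite in_setU1 in_setD1 tyI andbT zu orbN.
have zv' : z = v.
  by case: zv => // zI; case/negP: zn; rewrite !inE zu zI orbT.
rewrite zv' in iz; apply: indep_sub iz; apply/subsetP=> t; rewrite !inE.
by case/andP=> -> /or3P[->|->|->]; rewrite ?orbT.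
Qed.

Variables (lst : V -> pred nat) (x : V).
Implicit Types (col : V -> nat).

Definition sink col w d :=
  [&& lst w d, col w != d & indep M (w |: cls col d)].

(** Arcs of the exchange graph of matroid partition, restricted by the lists. *)
Definition arc col w u :=
  [&& lst w (col u), col w != col u & indep M ((w |: cls col (col u)) :\ u)].

Definition expand col (X : {set V}) : {set V} :=
  x |: (X :|: [set u | [exists w in X, arc col w u]]).

(** Starting from the empty set gives the vertices fewer than k arcs away from [x]; for k = 0 there
    are none, which ends the descent in [pInsertP]. *)
Definition reach col k : {set V} := iter k (expand col) set0.

Definition nosink col (X : {set V}) := forall w d, w \in X -> ~~ sink col w d.

(** Certificate that [x] cannot be inserted: R contains [x], no arc leaves it, and none of its
    members can enter a class freely. *)
Definition blocked col R := nosink col R /\ expand col R \subset R.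

Definition valid col :=
  (forall v, col v != 0 -> lst v (col v)) /\ (forall d, 0 < d ->
    indep M (cls col d)).

Hypothesis lst_gt0 : forall v d, lst v d -> 0 < d.

Lemma expand_mono col : {homo expand col : A B / A \subset B}.
Proof.
move=> A B AB; rewrite /expand setUS // setUSS //.
apply/subsetP=> u; rewrite !inE => /existsP[w /andP[wA wu]].
by apply/existsP; exists w; rewrite (subsetP AB).
Qed.

Lemma reach_mono col j k : j <= k -> reach col j \subset reach col k.
Proof.
move=> /subnK <-; elim: (k - j) => // m IH; apply: subset_trans IH _.
by rewrite addSn /= /expand setUCA subsetUl.
Qed.

(** A monotone operator on subsets of V reaches its least fixed point from the empty set in |V|
    steps. *)
Lemma reach_blocked col : nosink col (reach col #|V|) ->
  blocked col (reach col #|V|).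
Proof. by move=> ns; split=> //; rewrite (fixsetK (@expand_mono col)). Qed.

Lemma reach_sub_blocked col R k : blocked col R -> reach col k \subset R.
Proof.
case=> _ ER; elim: k => [|k IH] /=; first exact: sub0set.
by apply: subset_trans ER; apply: expand_mono.
Qed.

Lemma sink_valid col w d : valid col -> sink col w d -> valid (upd col w d).
Proof.
move=> [vl vi] /and3P[lwd cwd iwd]; split=> [v|k k0].
  by rewrite /upd; case: (eqVneq v w) => [->|_] //; apply: vl.
have [->|kd] := eqVneq k d; first by rewrite cls_upd_new.
have [kw|kw] := eqVneq k (col w); last by rewrite cls_upd_other ?vi.
rewrite kw cls_upd_old 1?eq_sym //; apply: (indep_sub (subsetDl _ _)).
by apply: vi; rewrite -kw.
Qed.

(** If the class of u receives v, [indep_swapU] applies because y is no sink; if it loses v,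
    independence is inherited; otherwise it is unchanged. *)
Lemma arc_upd col v d y u :
  sink col v d -> (forall k, ~~ sink col y k) -> y != v -> u != v ->
  arc col y u -> arc (upd col v d) y u.
Proof.
move=> sv ny yv uv /and3P[lyu cyu iyu].
have updE z : z != v -> upd col v d z = col z by rewrite /upd => /negbTE ->.
rewrite /arc !updE // lyu cyu /=.
move: (sv) => /and3P[_ cvd ivd].
have niy : ~~ indep M (y |: cls col (col u)).
  by have := ny (col u); rewrite /sink lyu cyu.
have [ud|ud] := eqVneq (col u) d.
  rewrite ud cls_upd_new in iyu niy cyu *.
  by apply: indep_swapU; rewrite ?inE ?ud.
have [uw|uw] := eqVneq (col u) (col v); last by rewrite cls_upd_other.
rewrite uw in iyu *; rewrite cls_upd_old 1?eq_sym //.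
by apply: indep_sub iyu; rewrite setSD // setUS // subsetDl.
Qed.

(* Moving a nearest sink into its free class keeps every arc between vertices
   that are strictly nearer, and turns its predecessor into a sink. *)
Lemma sink_step col k w d :
  nosink col (reach col k) -> w \in reach col k.+1 -> sink col w d -> w != x ->
  exists y b, y \in reach (upd col w d) k /\ sink (upd col w d) y b.
Proof.
move=> ns wk sw wx; have wNk : w \notin reach col k.
  by apply/negP=> wk'; have := ns w d wk'; rewrite sw.
have sub j : j <= k -> reach col j \subset reach (upd col w d) j.
  elim: j => [|j IH] jk; first exact: subxx.
  have rj := subsetP (IH (ltnW jk)).
  apply/subsetP=> u uj; have uw : u != w.
    apply: contraNneq wNk => <-; exact: (subsetP (reach_mono col jk)).
  move: uj; rewrite /= !inE => /or3P[->//|/rj ->|]; first by rewrite orbT.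
  case/existsP=> y /andP[yj yu]; apply/orP; right; apply/orP; right.
  apply/existsP; exists y; rewrite rj //=.
  have yk : y \in reach col k by apply: (subsetP (reach_mono col (ltnW jk))).
  apply: arc_upd => //; first by move=> b; apply: ns.
  by apply: contraNneq wNk => <-.
move: wk; rewrite /= in_setU1 (negbTE wx) in_setU (negbTE wNk) /= inE.
case/existsP=> y /andP[yk /and3P[lyw cyw iyw]].
have yw : y != w by apply: contraNneq wNk => <-.
have /and3P[_ cwd _] := sw.
exists y, (col w); split; first exact: (subsetP (sub k (leqnn k))).
rewrite /sink lyw {1}/upd (negbTE yw) cyw /= cls_upd_old 1?eq_sym //.
apply: indep_sub iyw; apply/subsetP=> z; rewrite !inE.
by case/orP=> [/eqP ->|/andP[-> ->]]; rewrite ?yw ?eqxx ?orbT.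
Qed.

(** Otherwise some y in K extends the part of class d inside R. It cannot extend the whole class, as
    R has no sink, so by [indep_swap] it can replace a vertex of d outside R, and that arc would
    leave R. *)
Lemma blocked_card col R d K :
  valid col -> blocked col R -> indep M K -> K \subset R -> 0 < d ->
  (forall v, v \in K -> lst v d) -> #|K| <= #|cls col d :&: R|.
Proof.
move=> [_ vi] [ns ER] iK KR d0 Kd; rewrite leqNgt; apply/negP=> lt.
have iI := vi d d0.
have [y] := indep_aug (indep_sub (subsetIl _ R) iI) iK lt.
rewrite 2!inE => /andP[yn yK] iy; have yR := subsetP KR y yK.
have yd : y \notin cls col d by apply: contra yn => ->.
have cyd : col y != d by move: yd; rewrite inE.
have niy : ~~ indep M (y |: cls col d).
  by have := ns y d yR; rewrite /sink Kd // cyd.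
have [u [ud uR iu]] := indep_swap iI yd iy niy.
have {}ud : col u = d by move: ud; rewrite inE => /eqP.
case/negP: uR; apply: (subsetP ER); rewrite !inE; apply/orP; right.
apply/orP; right; apply/existsP; exists y.
by rewrite yR /arc ud Kd // cyd.
Qed.

Lemma blocked_root col R : blocked col R -> x \in R.
Proof. by case=> _ /subsetP; apply; rewrite setU11. Qed.

(** Summing [blocked_card] over the classes of g shows that [col] places all of R, although x lies
    in R and is unplaced. *)
Lemma blocked_uncolorable col R (g : V -> nat) m :
  valid col -> blocked col R -> col x = 0 ->
  (forall v, g v < m) -> (forall v, lst v (g v)) ->
  (forall d, indep M (cls g d)) -> False.
Proof.
move=> vc bR x0 gm lg ig; have xR := blocked_root bR.
suff : #|R| <= #|R :\ x| by rewrite (cardsD1 x R) xR ltnn.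
have part (h : V -> nat) (S : {set V}) :
    \sum_(d < m) #|cls h d :&: S| = \sum_(v in S) (h v < m).
  transitivity (\sum_(d < m) \sum_(v in S) (h v == d)).
    apply: eq_bigr => d _; rewrite -sum1_card big_mkcond [RHS]big_mkcond /=.
    by apply: eq_bigr => v _; rewrite !inE; case: (v \in S); case: eqP.
  rewrite exchange_big; apply: eq_bigr => v _ /=.
  case: ltnP => hv; last first.
    by apply: big1 => d _; case: eqP => // hd; have := ltn_ord d; lia.
  rewrite (bigD1 (Ordinal hv)) //= eqxx big1 // => d.
  by rewrite -val_eqE eq_sym /= => /negbTE ->.
have -> : #|R| = \sum_(d < m) #|cls g d :&: R|.
  by rewrite part -sum1_card; apply: eq_bigr => v _; rewrite gm.
apply: (@leq_trans (\sum_(d < m) #|cls col d :&: (R :\ x)|)); last first.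
  by rewrite part -sum1_card; apply: leq_sum => v _; case: (_ < m).
apply: leq_sum => d _; have [d0|d0] := posnP d.
  rewrite d0 (_ : cls g 0 = set0) ?set0I ?cards0 //.
  apply/setP=> v; rewrite !inE; apply/negbTE.
  by have := lst_gt0 (lg v); case: (g v).
have -> : cls col d :&: (R :\ x) = cls col d :&: R.
  by apply/setP=> v; rewrite !inE; case: (eqVneq v x) => // ->; rewrite x0;
    case: eqP => // d1; rewrite -d1 in d0.
apply: blocked_card => //; first exact: indep_sub (subsetIl _ _) (ig d).
  exact: subsetIr.
by move=> v; rewrite !inE => /andP[/eqP <-].
Qed.

(* A list-coloring form of Greene's multiple symmetric exchange. *)
Lemma exchange_not_blocked col R (A B J : {set V}) a b :
  0 < a -> 0 < b -> valid col -> blocked col R -> x \in J -> col x = 0 ->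
  indep M (A :|: B) -> indep M J ->
  cls col a \subset A :|: J -> cls col b \subset B :|: J -> a != b ->
  (forall v, v \in A :|: J -> lst v a) -> (forall v, v \in B :|: J ->
    lst v b) ->
  False.
Proof.
move=> a0 b0 vc bR xJ x0 iAB iJ cA cB ab la lb.
have xR := blocked_root bR.
have iAB' : indep M ((A :|: B) :&: R) by apply: indep_sub iAB; apply: subsetIl.
have iJ' : indep M (J :&: R) by apply: indep_sub iJ; apply: subsetIl.
(* K contains J within R and is at least as large as A u B within R: a single independent set to be
   compared with both classes. *)
have [K [JK KU iK cK]] := indep_extend iJ' iAB'.
have KR : K \subset R.
  by apply: subset_trans KU _; rewrite subUset !subsetIr.
have Ka : #|K :&: (A :|: J)| <= #|cls col a :&: R|.
  apply: blocked_card => //; first by apply: indep_sub iK; apply: subsetIl.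
    by apply: subset_trans KR; apply: subsetIl.
  by move=> v; rewrite inE => /andP[_]; apply: la.
have Kb : #|K :&: (B :|: J)| <= #|cls col b :&: R|.
  apply: blocked_card => //; first by apply: indep_sub iK; apply: subsetIl.
    by apply: subset_trans KR; apply: subsetIl.
  by move=> v; rewrite inE => /andP[_]; apply: lb.
(* Every element of K is counted at least once on the right, and those of J within R twice. *)
have KK : #|K| + #|J :&: R| <= #|K :&: (A :|: J)| + #|K :&: (B :|: J)|.
  rewrite -[X in _ <= X]cardsUI leq_add //; apply: subset_leq_card;
    apply/subsetP=> v.
    move=> vK; move: (subsetP KU v vK); rewrite !inE vK /=.
    by case: (v \in A); case: (v \in B); case: (v \in J).
  by move=> vJ; rewrite in_setI !in_setI (subsetP JK v vJ); move: vJ;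
    rewrite !inE => /andP[-> _]; rewrite !orbT.
(* Strict because the classes a and b are disjoint, lie in A u B u J, and miss x. *)
have cab : #|cls col a :&: R| + #|cls col b :&: R| <
  #|(A :|: B) :&: R| + #|J :&: R|.
  have -> : #|cls col a :&: R| + #|cls col b :&: R| =
    #|(cls col a :|: cls col b) :&: R|.
    rewrite setIUl -cardsUI.
    rewrite (_ : (_ :&: R) :&: (_ :&: R) = set0) ?cards0 ?addn0 //.
    apply/setP=> v; rewrite !inE;
      apply/negbTE/negP=> /andP[/andP[/eqP va _] /andP[/eqP vb _]].
    by rewrite -va vb eqxx in ab.
  apply: (@leq_trans #|((A :|: B) :|: J) :&: R|); last first.
    by rewrite setIUl; apply: leq_card_setU.
  apply: proper_card; apply/properP; split.
    apply: setSI; rewrite subUset (subset_trans cA) /=; last first.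
      by apply: setSU; apply: subsetUl.
    by apply: subset_trans cB _; apply: setSU; apply: subsetUr.
  exists x; first by rewrite !inE xJ xR orbT.
  by rewrite !inE x0 !(eq_sym 0) !gtn_eqF.
by have := leq_trans KK (leq_add Ka Kb); lia.
Qed.

End Augment.

(** * Programs for augmentation *)

(* Scalars: 0 |V|, 1 the element x to insert, 3 the level, 4-6 w, d, u for the
   exchange of w for u in class d, 7 query answers, 8 whether a vertex
   was moved, 9 the number r of sets, 10 the stage, 11 the color being used.
   Arrays: 2 the classes, as rows; 3 the lists of allowed classes; 4 one plus
   the distance from x (0 if not reached); 5 the class of an element; 6 a
   scratch row; 7 the elements of J_(c+1) not yet committed to I. *)

Definition eNot e := EEq e (EConst 0).
(** De Morgan with addition as disjunction, since the machine has no multiplication; any nonzero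
    value counts as true. *)
Definition eAnd e1 e2 := eNot (EAdd (eNot e1) (eNot e2)).
Arguments eNot : simpl never.
Arguments eAnd : simpl never.

Lemma eval_not s e : (eval s (eNot e) != 0) = (eval s e == 0).
Proof. by rewrite /eNot /=; case: (eval s e). Qed.

Lemma eval_and s e1 e2 :
  (eval s (eAnd e1 e2) != 0) = (eval s e1 != 0) && (eval s e2 != 0).
Proof. by rewrite /eAnd /eNot /=; case: (eval s e1); case: (eval s e2). Qed.

(** The invariant is indexed by the set P of index triples already visited. The loop order enters
    only through the guarantee that all triples with a smaller outermost index are done, which is
    what finding a nearest vertex requires. *)
Lemma run_for3 (V : finType) (O : pred {set V})
    (Inv : (nat -> nat -> nat -> Prop) -> state -> Prop)
    i1 k1 i2 k2 i3 k3 b s (n := scalar s 0) :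
  uniq [:: i1; i2; i3] -> 0 \notin [:: i1; i2; i3] ++ mods b ->
  all (fun i => i \notin mods b) [:: i1; i2; i3] ->
  (forall P s1 i k, i \in [:: i1; i2; i3] -> Inv P s1 ->
     Inv P (set_scalar s1 i k)) ->
  (forall P Q s1, (forall a b c, Q a b c -> P a b c) -> Inv P s1 -> Inv Q s1) ->
  (forall P a c d s1, a < n + k1 -> c < n + k2 -> d < n + k3 ->
     [/\ scalar s1 i1 = a, scalar s1 i2 = c & scalar s1 i3 = d] ->
     (forall y, y \notin [:: i1; i2; i3] ++ mods b ->
        scalar s1 y = scalar s y) ->
     (forall e, e \notin moda b ->
        forall i j, array s1 e i j = array s e i j) ->
     (forall a' c' d', a' < a -> c' < n + k2 -> d' < n + k3 -> P a' c' d') ->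
     Inv P s1 ->
     Inv (fun a' c' d' => P a' c' d' \/ [/\ a' = a, c' = c & d' = d])
       (run O b s1)) ->
  Inv (fun _ _ _ => False) s ->
  Inv (fun a c d => [/\ a < n + k1, c < n + k2 & d < n + k3])
    (run O (For i1 k1 (For i2 k2 (For i3 k3 b))) s).
Proof.
move=> U Z L Iset Iw step I0.
move: U Z L; rewrite /= !inE !negb_or => /and3P[/andP[i12 i13] i23 _].
move=> /and4P[i10 i20 i30 b0] /and4P[i1b i2b i3b _].
pose P1 a := fun a' c d => [/\ a' < a, c < n + k2 & d < n + k3].
pose P2 a c := fun a' c' d' =>
  P1 a a' c' d' \/ [/\ a' = a, c' < c & d' < n + k3].
pose P3 a c d := fun a' c' d' =>
  P2 a c a' c' d' \/ [/\ a' = a, c' = c & d' < d].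
change (Inv (P1 (n + k1)) (run O (For i1 k1 (For i2 k2 (For i3 k3 b))) s)).
apply: (@run_for _ _ (fun a => Inv (P1 a))).
  apply: (Iset); first by rewrite !inE eqxx.
  by apply: (Iw) I0 => a c d [].
move=> a s1 an s1a fs1 fa1 I1; apply: (Iset); first by rewrite !inE eqxx.
have n1 : scalar s1 0 = n by rewrite fs1 //= !inE !negb_or i10 i20 i30.
suff: Inv (P2 a (scalar s1 0 + k2)) (run O (For i2 k2 (For i3 k3 b)) s1).
  apply: (Iw) => a' c' d' [];
    rewrite ltnS leq_eqVlt n1 => /orP[/eqP ->|a'a] c'n d'n.
    by right.
  by left.
apply: (@run_for _ _ (fun c => Inv (P2 a c))).
  apply: (Iset); first by rewrite !inE eqxx orbT.
  by apply: (Iw) I1 => a' c' d' [[? ? ?]|[]].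
move=> c s2 cn s2c fs2 fa2 I2; apply: (Iset); first by rewrite !inE eqxx orbT.
rewrite n1 in cn; have n2 : scalar s2 0 =
  n by rewrite fs2 //= !inE !negb_or i20 i30.
have s2a : scalar s2 i1 = a by rewrite fs2 ?s1a //= !inE !negb_or i12 i13.
suff: Inv (P3 a c (scalar s2 0 + k3)) (run O (For i3 k3 b) s2).
  apply: (Iw) => a' c' d'; rewrite n2 => -[?|[-> ]]; first by left; left.
  rewrite ltnS leq_eqVlt => /orP[/eqP ->|c'c] d'n; first by right.
  by left; right.
apply: (@run_for _ _ (fun d => Inv (P3 a c d))).
  apply: (Iset); first by rewrite !inE eqxx !orbT.
  by apply: (Iw) I2 => a' c' d' [|[]].
move=> d s3 dn s3d fs3 fa3 I3; apply: (Iset); first by rewrite !inE eqxx !orbT.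
rewrite n2 in dn.
apply: (Iw (fun a' c' d' => P3 a c d a' c' d' \/ [/\ a' = a, c' = c & d' = d])).
  move=> a' c' d' [?|[-> -> ]]; first by left; left.
  by rewrite ltnS leq_eqVlt => /orP[/eqP ->|?]; [right|left; right].
apply: step I3 => //; first 1 last.
- move=> y; rewrite !inE !negb_or => /and4P[y1 y2 y3 yb].
  by rewrite fs3 ?fs2 ?fs1 // !inE !negb_or ?y1 ?y2 ?y3 ?yb.
- by move=> e eb i j; rewrite fa3 ?fa2 ?fa1.
- by move=> a' c' d' a'a c'n d'n; left; left.
split=> //; first by rewrite fs3 ?s2a // inE negb_or i13.
by rewrite fs3 ?s2c // inE negb_or i23.
Qed.

Definition eCO x := EGet 5 (EVar x) (EConst 0).
Definition eD x := EGet 4 (EConst 0) (EVar x).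

Definition pSet x e :=
  Seq (Put 2 (eCO x) (EVar x) (EConst 0))
    (Seq (Put 2 e (EVar x) (EConst 1)) (Put 5 (EVar x) (EConst 0) e)).

Definition pTestAdd :=
  Seq (Put 2 (EVar 5) (EVar 4) (EConst 1))
    (Seq (Query 7 2 (EVar 5)) (Put 2 (EVar 5) (EVar 4) (EConst 0))).

Definition pTestSwap :=
  Seq (Put 2 (EVar 5) (EVar 6) (EConst 0))
    (Seq pTestAdd (Put 2 (EVar 5) (EVar 6) (EConst 1))).

Definition gLevel :=
  eAnd (eAnd (eD 4) (ELt (eD 4) (EAdd (EVar 3) (EConst 2))))
    (eAnd (eAnd (EEq (eCO 6) (EVar 5)) (eNot (eD 6)))
       (eAnd (EGet 3 (EVar 4) (EVar 5)) (eNot (EEq (eCO 4) (EVar 5))))).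

Definition pLevelBody :=
  If gLevel
    (Seq pTestSwap
       (If (EVar 7) (Put 4 (EConst 0) (EVar 6) (EAdd (EVar 3) (EConst 2)))
         Skip))
    Skip.

(** Breadth-first search. The class loop extends to |V| + 1 because up to |V| sets are numbered from
    class 2 on. *)
Definition pLevels :=
  Seq (For 6 0 (Put 4 (EConst 0) (EVar 6) (EConst 0)))
    (Seq (Put 4 (EConst 0) (EVar 1) (EConst 1))
       (For 3 0 (For 4 0 (For 5 2 (For 6 0 pLevelBody))))).

Definition gMove :=
  eAnd (eAnd (eNot (EVar 8)) (EEq (eD 4) (EAdd (EVar 3) (EConst 1))))
    (eAnd (EGet 3 (EVar 4) (EVar 5)) (eNot (EEq (eCO 4) (EVar 5)))).

Definition pMoveBody :=
  If gMove
    (Seq pTestAdd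
       (If (EVar 7) (Seq (pSet 4 (EVar 5)) (Assign 8 (EConst 1))) Skip))
    Skip.

Definition pMove :=
  Seq (Assign 8 (EConst 0)) (For 3 0 (For 4 0 (For 5 2 pMoveBody))).

(** |V| attempts suffice: each move brings a nearest sink at least one step closer to the root. The
    search is redone every time because a move changes the exchange graph. *)
Definition pInsert :=
  For 2 0 (If (eCO 1) Skip (Seq pLevels pMove)).

(** * Memory representation of the classes and single oracle tests *)

Section Rep.
Variables (V : finType) (M : matroid V).
Implicit Types (s : state) (col : V -> nat) (u v w : V) (d k : nat).
Local Notation run := (run (indep M)).

Definition rk (v : V) : nat := enum_rank v.

Lemma rk_lt v : rk v < #|V|. Proof. exact: ltn_ord. Qed.

Lemma rk_eq u v : (rk u == rk v) = (u == v).
Proof. by rewrite /rk val_eqE (inj_eq enum_rank_inj). Qed.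

Lemma rk_ex j : j < #|V| -> exists v, rk v = j.
Proof. by move=> jn; exists (enum_val (Ordinal jn)); rewrite /rk enum_valK. Qed.

(** The coloring is stored twice: by vertex for guards, and as rows because an oracle query takes a
    row. *)
Definition rep s col :=
  forall v, array s 5 (rk v) 0 = col v /\
            forall d, array s 2 d (rk v) = (col v == d).

Lemma rep_ext s1 s2 col :
  (forall a i j, a \in [:: 2; 5] -> array s1 a i j = array s2 a i j) ->
  rep s2 col -> rep s1 col.
Proof.
move=> e r v; have [r5 r2] := r v; split; first by rewrite e.
by move=> d; rewrite e.
Qed.

Lemma rep_co s col x v :
  rep s col -> scalar s x = rk v -> eval s (eCO x) = col v.
Proof. by move=> r sx; rewrite /= sx; have [] := r v. Qed.

(** [pSet] evaluates e again after changing arrays, so the value of e must depend on scalars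
    only. *)
Lemma rep_pSet s col x w e k :
  rep s col -> scalar s x = rk w ->
  (forall s', (forall y, scalar s' y = scalar s y) -> eval s' e = k) ->
  rep (run (pSet x e) s) (upd col w k).
Proof.
move=> r sx se v; rewrite /= sx !se //; have [r5 r2] := r v.
rewrite !rk_eq /upd; have [vw|vw] := eqVneq v w; split=> //.
- move=> d; rewrite !andbT r2 (r w).1 vw (eq_sym k) (eq_sym _ d).
  by case: (d == k) => //; case: (d == col w).
- by move=> d; rewrite !andbF.
Qed.

Lemma rep_row s col d : rep s col -> row_set V s 2 d = cls col d.
Proof.
move=> r; apply/setP=> v; rewrite !inE; have [_ ->] := r v.
by case: (col v == d).
Qed.

Lemma pTestAdd_set s w d A :
  scalar s 4 = rk w -> scalar s 5 = d -> row_set V s 2 d = A ->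
  scalar (run pTestAdd s) 7 = indep M (w |: A).
Proof.
move=> s4 s5 <- /=; congr (nat_of_bool (indep M _)); apply/setP=> v.
by rewrite !inE /= s4 s5 eqxx rk_eq /=; case: (v == w).
Qed.

(** The test clears the bit of w afterwards; this restores the row only because w is not in class
    d. *)
Lemma pTestAddP s col w d :
  rep s col -> scalar s 4 = rk w -> scalar s 5 = d -> col w != d ->
  rep (run pTestAdd s) col /\
  scalar (run pTestAdd s) 7 = indep M (w |: cls col d).
Proof.
move=> r s4 s5 wd; split; last exact: (pTestAdd_set s4 s5 (rep_row d r)).
apply: rep_ext (r) => a i j _ /=; rewrite s4 s5.
case: and3P => // -[/eqP -> /eqP -> /eqP ->].
by have [_ ->] := r w; rewrite (negbTE wd).
Qed.

Lemma pTestSwapP s col w u d :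
  rep s col -> scalar s 4 = rk w -> scalar s 5 = d -> scalar s 6 = rk u ->
  col w != d -> col u = d ->
  rep (run pTestSwap s) col /\
  scalar (run pTestSwap s) 7 = indep M ((w |: cls col d) :\ u).
Proof.
move=> r s4 s5 s6 wd ud; have wu : w != u by apply: contraNneq wd => ->;
  rewrite ud.
split.
  apply: rep_ext (r) => a i j _ /=; rewrite s4 s5 s6.
  case: and3P => [[/eqP -> /eqP -> /eqP ->]|_].
    by have [_ ->] := r u; rewrite ud eqxx.
  case: and3P => // -[/eqP -> /eqP -> /eqP ->].
  by have [_ ->] := r w; rewrite (negbTE wd).
rewrite -[LHS]/(scalar (run pTestAdd (set_array s 2 (scalar s 5) (scalar s 6)
  0)) 7).
rewrite (@pTestAdd_set _ w d (cls col d :\ u)) //; last first.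
  apply/setP=> v; rewrite !inE /= s5 s6 eqxx rk_eq; have [_ ->] := r v.
  by case: (v == u) => //=; case: (col v == d).
congr (nat_of_bool (indep M _)); apply/setP=> v; rewrite !inE.
by case: eqP => // ->; rewrite wu.
Qed.

End Rep.

Arguments run : simpl never.

(** * Breadth-first levels, moving a nearest sink, and insertion of one vertex *)

Section Insert.
Variables (V : finType) (M : matroid V) (lst : V -> pred nat) (x : V).
Implicit Types (s : state) (col : V -> nat) (u v w : V) (d k : nat).
Local Notation run := (run (indep M)).
Local Notation reach := (reach M lst x).
Local Notation nosink := (nosink M lst).
Local Notation sink := (sink M lst).
Local Notation arc := (arc M lst).
Local Notation n := #|V|.

Hypothesis lst_bound : forall v d, lst v d -> 0 < d < n + 2.

Let lst_gt0 v d : lst v d -> 0 < d.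
Proof. by move=> /lst_bound /andP[]. Qed.

Definition replst s :=
  forall v d, d < n + 2 -> (array s 3 (rk v) d != 0) = lst v d.

Definition lev s u := array s 4 0 (rk u).

Definition levels col m s :=
  (forall k, k <= m -> forall u, (0 < lev s u <= k.+1) = (u \in reach col k.+1))
  /\ (forall u, lev s u <= m.+1).

Lemma pLevelBodyP s col l w d u :
  rep s col -> replst s -> scalar s 3 = l -> scalar s 4 = rk w ->
  d < n + 2 -> scalar s 5 = d -> scalar s 6 = rk u ->
  let s' := run pLevelBody s in
  rep s' col /\
  forall v, lev s' v =
    if [&& v == u, 0 < lev s w <= l.+1, col u == d, lev s u == 0 & arc col w u]
    then l.+2 else lev s v.
Proof.
move=> r rl s3 s4 dn s5 s6 s'; rewrite {}/s' /pLevelBody run_if.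
have -> : (eval s gLevel != 0) =
    [&& 0 < lev s w <= l.+1, col u == d, lev s u == 0, lst w d & col w != d].
  rewrite /gLevel !eval_and !eval_not /= s3 s4 s5 s6 rl // (r w).1 (r u).1
    addn2.
  rewrite -/(lev s w) -/(lev s u) !ltnS lt0n !eqb0 !negbK -!andbA.
  by [].
case: ifPn => [/and5P[lw /eqP ud lu lwd wd]|nb]; last first.
  split=> // v; case: ifP => // /and5P[/eqP -> lw ud lu /and3P[a1 a2 _]].
  by case/negP: nb; rewrite lw ud lu; move/eqP: ud => <-; rewrite a1 a2.
have [r' s7] := pTestSwapP M r s4 s5 s6 wd ud.
have la v : array (run pTestSwap s) 4 0 (rk v) = lev s v by rewrite run_array.
have t3 : scalar (run pTestSwap s) 3 = l by rewrite run_scalar.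
have t6 : scalar (run pTestSwap s) 6 = rk u by rewrite run_scalar.
rewrite run_seq; move: (run pTestSwap s) r' s7 la t3 t6 => t r' t7 la t3 t6.
rewrite run_if run_put /= t3 t6 t7 lw ud lu eqxx /arc ud lwd wd /=.
set c := indep M _; case: c => /=; last first.
  by split=> // v; rewrite andbF /lev la.
split; first by apply: rep_ext r' => a i j; rewrite !inE => /orP[]/eqP ->.
move=> v; rewrite /lev /= rk_eq andbT la.
by case: ifP => //; rewrite addn2.
Qed.

Lemma mem_reach1 col k : x \in reach col k.+1.
Proof. by rewrite /= setU11. Qed.

Lemma levelsS s col l :
  scalar s 0 = n -> scalar s 3 = l -> rep s col -> replst s ->
  levels col l s ->
  let s' := run (For 4 0 (For 5 2 (For 6 0 pLevelBody))) s in
  rep s' col /\ levels col l.+1 s'.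
Proof.
move=> s0 s3 r rl [lv1 lv2] s'.
pose Inv (P : nat -> nat -> nat -> Prop) s :=
  [/\ rep s col,
      forall k, k <= l -> forall u, (0 < lev s u <= k.+1) =
        (u \in reach col k.+1),
      forall u, lev s u <= l.+2,
      forall u, lev s u = l.+2 -> u \in reach col l.+2
    & forall a b c, P a b c -> forall w u, rk w = a -> col u = b -> rk u = c ->
      w \in reach col l.+1 -> arc col w u -> lev s u != 0].
have [] : Inv (fun a b c => [/\ a < scalar s 0 + 0, b < scalar s 0 + 2
                                & c < scalar s 0 + 0]) s'.
  apply: run_for3 => //.
  - by move=> P Q s1 QP [i1 i2 i3 i4 i5]; split=> // a b c /QP; apply: i5.
  - move=> P a b c s1; rewrite s0 !addn0 =>
    an bn cn [s4 s5 s6] fs fa _ [i1 i2 i3 i4 i5].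
    have [w wa] := rk_ex an; have [u uc] := rk_ex cn.
    have rl1 : replst s1 by move=> v d dn; rewrite fa ?rl.
    have s13 : scalar s1 3 = l by rewrite fs.
    rewrite -wa in s4; rewrite -uc in s6.
    have [r1 l1] := pLevelBodyP i1 rl1 s13 s4 bn s5 s6.
    split=> //.
    (* Only zero entries are overwritten, and the new value l + 2 exceeds all earlier thresholds. *)
    + move=> k kl v; rewrite -i2 // l1;
      case: ifP => // /and5P[/eqP -> _ _ /eqP -> _].
      by lia.
    + by move=> v; rewrite l1; case: ifP.
    + move=> v; rewrite l1; case: ifP => [|_]; last exact: i4.
      case/and5P=> /eqP -> lw _ _ au _;
        rewrite [reach _ _]/= in_setU1 in_setU inE.
      apply/orP; right; apply/orP; right; apply/existsP; exists w.
      by rewrite au andbT -i2.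
    + move=> a' b' c' H w' u' w'a u'b u'c w'r au; rewrite l1;
      case: ifPn => // nb.
      case: H => [H|[aa bb cc]]; first by apply: i5 H w' u' w'a u'b u'c w'r au.
      have ew : w' = w by apply/eqP; rewrite -rk_eq w'a aa wa.
      have eu : u' = u by apply/eqP; rewrite -rk_eq u'c cc uc.
      apply: contra nb => lu; rewrite -ew -eu eqxx au lu u'b bb eqxx.
      by rewrite i2 // w'r.
  - by split=> // u; [have := lv2 u; lia|move=> lu; have := lv2 u;
    rewrite lu ltnn].
move=> i1 i2 i3 i4 i5; split=> //; split=> // k kl u.
have [kl'|kl'] := ltnP k l.+1; first exact: i2.
have -> : k = l.+1 by lia.
apply/idP/idP=> [/andP[u0]|].
  rewrite leq_eqVlt => /orP[/eqP/i4 //|ul].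
  by apply: (subsetP (reach_mono M lst x col (leqnSn _))); rewrite -i2 // u0.
rewrite i3 andbT [reach _ _]/= in_setU1 in_setU inE -/(reach col l.+1) =>
  /or3P[/eqP ->|ur|].
- by have := mem_reach1 col l; rewrite -i2 // => /andP[].
- by move: ur; rewrite -i2 // => /andP[].
case/existsP=> w /andP[wr au]; rewrite lt0n.
apply: (i5 (rk w) (col u) (rk u) _ w u) => //; rewrite s0 addn0; split;
  rewrite ?rk_lt //.
by have /and3P[/lst_bound/andP[]] := au.
Qed.

Lemma pLevelsP s col :
  scalar s 0 = n -> scalar s 1 = rk x -> rep s col -> replst s ->
  rep (run pLevels s) col /\ levels col n (run pLevels s).
Proof.
move=> s0 s1 r rl; rewrite /pLevels.
set p1 := For 6 0 _; set p2 := Put 4 _ _ _.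
rewrite !run_seq; set sA := run p1 s; set sB := run p2 sA.
have lA v : lev sA v = 0.
  have : forall v, rk v < scalar s 0 + 0 -> lev sA v = 0.
    apply: (@run_for _ _ (fun j s' => forall v, rk v < j ->
      lev s' v = 0)) => //.
    move=> j s' _ s'6 _ _ IH u; rewrite ltnS leq_eqVlt /lev run_put /= s'6.
    by case: eqP => //= _ /IH.
  by apply; rewrite s0 addn0 rk_lt.
have lB v : lev sB v = (v == x).
  rewrite /lev /sB run_put /= /sA run_scalar // s1 rk_eq -/sA -/(lev sA v) lA.
  by case: eqP.
have : rep (run (For 3 0 (For 4 0 (For 5 2 (For 6 0 pLevelBody)))) sB) col /\
  levels col (scalar sB 0 +
    0) (run (For 3 0 (For 4 0 (For 5 2 (For 6 0 pLevelBody)))) sB).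
  apply: (@run_for _ _ (fun j s' => rep s' col /\ levels col j s')).
    split; first by apply: rep_ext r => a i j;
      rewrite !inE /sB /= => /orP[]/eqP ->; rewrite run_array.
    split=> [k|u]; last by rewrite -[lev _ u]/(lev sB u) lB; case: eqP.
    rewrite leqn0 => /eqP -> u; rewrite -[lev _ u]/(lev sB u) lB /= !inE.
    case: eqP => //= _; apply/esym/negbTE/negP=> /existsP[w].
    by rewrite inE.
  move=> j s' _ s'3 fs fa [r' l'].
  have := @levelsS s' col j;
    rewrite fs // [scalar sB 0]run_scalar // run_scalar //.
  by apply=> // v d dn; rewrite fa // /sB run_array // run_array ?rl.
by rewrite [scalar sB 0]run_scalar // run_scalar // s0 addn0.
Qed.

(** The absence of sinks in [reach col l] records that the moved vertex was a nearest one, as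
    [sink_step] demands. *)
Definition moved col s := exists l w d,
  [/\ l < n, w \in reach col l.+1, nosink col (reach col l), sink col w d
    & rep s (upd col w d)].

Lemma pMoveBodyP s col l w d :
  rep s col -> replst s -> scalar s 3 = l -> scalar s 4 = rk w ->
  d < n + 2 -> scalar s 5 = d -> scalar s 8 = 0 ->
  if (lev s w == l.+1) && sink col w d
  then scalar (run pMoveBody s) 8 = 1 /\ rep (run pMoveBody s) (upd col w d)
  else scalar (run pMoveBody s) 8 = 0 /\ rep (run pMoveBody s) col.
Proof.
move=> r rl s3 s4 dn s5 s8; rewrite /pMoveBody run_if.
have -> : (eval s gMove != 0) = [&& lev s w == l.+1, lst w d & col w != d].
  rewrite /gMove !eval_and !eval_not /= s3 s4 s5 s8 rl // (r w).1 addn1.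
  by rewrite -/(lev s w) !eqb0 !negbK.
rewrite /sink; case: (boolP [&& lev s w == l.+1, lst w d & col w != d]) =>
  [/and3P[lw lwd wd]|nb]; last first.
  case: ifPn => [/and4P[lw lwd wd _]|_]; last by split.
  by rewrite lw lwd wd in nb.
have [r' s7] := pTestAddP M r s4 s5 wd.
have t8 : scalar (run pTestAdd s) 8 = 0 by rewrite run_scalar.
have t4 : scalar (run pTestAdd s) 4 = rk w by rewrite run_scalar.
have t5 : scalar (run pTestAdd s) 5 = d by rewrite run_scalar.
rewrite run_seq lw lwd wd;
  move: (run pTestAdd s) r' s7 t8 t4 t5 => t r' t7 t8 t4 t5.
rewrite run_if [eval _ _]/= t7 eqb0 negbK /=.
case: (indep M _); last by split.
rewrite run_seq run_assign; split; first by [].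
apply: (rep_ext (s2 := run (pSet 4 (EVar 5)) t)) => //.
by apply: rep_pSet => // t' ft; rewrite /= ft.
Qed.

Lemma pMoveP s col :
  scalar s 0 = n -> rep s col -> replst s -> levels col n s ->
  let s' := run pMove s in
  (rep s' col /\ nosink col (reach col n)) \/ moved col s'.
Proof.
move=> s0 r rl [lv1 _] s'; rewrite {}/s' /pMove run_seq.
rewrite run_assign; set sA := set_scalar _ _ _.
pose Inv (P : nat -> nat -> nat -> Prop) s' :=
  (scalar s' 8 = 0 /\ rep s' col /\
     forall a b c, P a b c -> forall w, rk w = b -> lev s w = a.+1 ->
     ~~ sink col w c) \/
  (scalar s' 8 = 1 /\ moved col s').
have nos P l : l <= n ->
    (forall a b c, a < l -> b < n -> c < n + 2 -> P a b c) ->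
    (forall a b c, P a b c -> forall w, rk w = b -> lev s w = a.+1 ->
       ~~ sink col w c) -> nosink col (reach col l).
  move=> ln PP H w d wl; apply/negP=> sw; move: (sw).
  have /andP[_ dn] := lst_bound (proj1 (andP sw)).
  case: l ln PP wl => [|l] ln PP; first by rewrite inE.
  rewrite -(lv1 _ (ltnW ln)) => /andP[w0 wl]; apply/negP.
  apply: (H (lev s w).-1 (rk w)) => //; last by rewrite prednK.
  by apply: PP => //; [lia|apply: rk_lt].
have : Inv (fun a b c => [/\ a < scalar sA 0 + 0, b < scalar sA 0 + 0
    & c < scalar sA 0 + 2]) (run (For 3 0 (For 4 0 (For 5 2 pMoveBody))) sA).
  apply: run_for3 => //.
  - move=> P s1 i k ii [[H1 [H2 H3]]|[H1 H2]]; [left|right].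
      by do !split=> //; move: ii; rewrite !inE => /or3P[]/eqP ->.
    by split=> //; move: ii; rewrite !inE => /or3P[]/eqP ->.
  - move=> P Q s1 QP [[H1 [H2 H3]]|H]; [left|by right].
    by do !split=> //; move=> a b c /QP; apply: H3.
  - move=> P a b c s1; rewrite /= s0 !addn0 => an bn cn [s3 s4 s5] fs fa Pa [].
      move=> [s8 [r1 H]]; have [w wb] := rk_ex bn; rewrite -wb in s4.
      have rl1 : replst s1 by move=> v d dn; rewrite fa ?rl.
      have := pMoveBodyP r1 rl1 s3 s4 cn s5 s8.
      have -> : lev s1 w = lev s w by rewrite /lev fa.
      case: ifPn => [/andP[/eqP lw sw]|nsw] [t8 rt].
        right; split=> //; exists a, w, c; split=> //.
          by rewrite -(lv1 _ (ltnW an)) lw leqnn.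
        apply: nos H; first exact: ltnW.
        by move=> a' b' c' a'a b'n c'n; apply: Pa.
      left; do 2!split=> //; move=> a' b' c' [|[-> -> ->]]; first exact: H.
      move=> w' w'b lw'; have -> : w' = w by apply/eqP; rewrite -rk_eq w'b wb.
      by move: nsw; rewrite (_ : w = w') ?lw' ?eqxx //; apply/eqP;
        rewrite -rk_eq w'b wb.
    move=> [s8 m]; right.
    (* Once the flag is set the guard fails. A second move would rely on levels that the first has
       made obsolete. *)
    have -> : run pMoveBody s1 = s1.
      by rewrite /pMoveBody run_if /gMove !eval_and !eval_not /= s8.
    by [].
  - by left.
case=> [[_ [r' H]]|[]]; [left|by right].
split=> //; apply: nos H => // a b c; rewrite /= s0 !addn0; split=> //.
Qed.

(** Arcs end in positive classes, so an augmentation only rearranges placed vertices, and [x] is the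
    only vertex it can newly place. *)
Lemma reach_colored col w k : w \in reach col k -> w != x -> col w != 0.
Proof.
elim: k w => [|k IH] w; first by rewrite inE.
rewrite [reach _ _]/= in_setU1 in_setU inE -/(reach col k).
case/or3P=> [->//|/IH //|/existsP[y /andP[_ /and3P[/lst_gt0]]]].
by rewrite lt0n.
Qed.

Lemma pInsertP s col :
  scalar s 0 = n -> scalar s 1 = rk x -> rep s col -> replst s ->
  valid M lst col -> col x = 0 ->
  exists col', let s' := run pInsert s in
  [/\ rep s' col', valid M lst col',
      forall v, v != x -> (col' v == 0) = (col v == 0)
    & col' x = 0 -> exists R, blocked M lst x col' R].
Proof.
move=> s0 s1 r rl vc cx.
(* While x is unplaced and no certificate exists, some sink is within [reach] of n - j; at j = n
   that set is empty. *)
pose Inv j s' := exists col',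
  [/\ rep s' col', valid M lst col',
      forall v, v != x -> (col' v == 0) = (col v == 0)
    & col' x = 0 -> (exists R, blocked M lst x col' R) \/
        exists w d, w \in reach col' (n - j) /\ sink col' w d].
have : Inv (scalar s 0 + 0) (run pInsert s).
  apply: run_for.
    exists col; split=> // _.
    have [|ns] := boolP [exists w in reach col n, [exists d : 'I_(n +
      2), sink col w d]].
      case/existsP=> w /andP[wn /existsP[d sw]]; right; exists w, d.
      by rewrite subn0.
    left; exists (reach col n); apply: reach_blocked => w d wn.
    apply: contra ns => sw; apply/existsP; exists w; rewrite wn /=;
      apply/existsP.
    have /andP[_ dn] := lst_bound (proj1 (andP sw)).
    by exists (Ordinal dn).
  move=> j s' jn s'2 fs fa [col' [r' v' dm bl]].
  have s'0 : scalar s' 0 = n by rewrite fs.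
  have s'1 : scalar s' 1 = rk x by rewrite fs.
  have rl' : replst s' by move=> v d dn; rewrite fa ?rl.
  rewrite run_if (rep_co r' s'1).
  have [x0|x0] := eqVneq (col' x) 0; last by exists col'; split=> //= x0';
    rewrite x0' in x0.
  rewrite run_seq; have [r2 l2] := pLevelsP s'0 s'1 r' rl'.
  have s20 : scalar (run pLevels s') 0 = n by rewrite run_scalar.
  have rl2 : replst (run pLevels s') by move=> v d dn; rewrite run_array ?rl'.
  have [[r3 ns]|[l [w [d [ln wl ns sw r3]]]]] := pMoveP s20 r2 rl2 l2.
    exists col'; split=> // _; left; exists (reach col' n).
    exact: reach_blocked.
  exists (upd col' w d); split=> //.
  - exact: sink_valid.
  - move=> v vx; rewrite /upd; case: (eqVneq v w) => [vw|_]; last exact: dm.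
    rewrite -dm // vw; have /and3P[/lst_gt0 d0 _ _] := sw.
    rewrite (gtn_eqF d0); apply/esym/negbTE.
    by apply: (reach_colored wl); rewrite -vw.
  have [wx ux|wx _] := eqVneq w x.
    have /and3P[/lst_gt0 d0 _ _] := sw.
    by move: ux d0; rewrite /upd wx eqxx => ->.
  case: (bl x0) => [[R bR]|[w' [d' [w'r sw']]]].
    have wR := subsetP (reach_sub_blocked l.+1 bR) w wl.
    by case: bR => /(_ w d wR); rewrite sw.
  right; have [y [b [yr sy]]] := sink_step ns wl sw wx.
  exists y, b; split=> //; apply: (subsetP (reach_mono _ _ _ _ _)) yr.
  (* The invariant puts a sink in [reach] of n - j, but there is none in [reach] of l, so l < n -
     j. *)
  rewrite leqNgt; apply/negP=> nl;
    suff /(ns w' d') : w' \in reach col' l by rewrite sw'.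
  by apply: (subsetP (reach_mono _ _ _ _ _)) w'r; lia.
rewrite s0 addn0 => -[col' [r' v' dm bl]]; exists col'; split=> // x0.
by case: (bl x0) => // -[w [d []]]; rewrite subnn inE.
Qed.

End Insert.

(** * Partition into independent sets *)

(* Class d + 1 stands for the d-th set of the partition; class 1 is reserved for
   the color class under construction, class 0 holds the unplaced elements. *)
Definition pNewClass :=
  Seq (Assign 9 (EAdd (EVar 9) (EConst 1)))
    (Seq (pSet 1 (EAdd (EVar 9) (EConst 1)))
       (For 12 0 (Put 3 (EVar 12) (EAdd (EVar 9) (EConst 1)) (EConst 1)))).

Definition pLoopTest :=
  Seq (Put 6 (EConst 0) (EVar 1) (EConst 1))
    (Seq (Query 7 6 (EConst 0)) (Put 6 (EConst 0) (EVar 1) (EConst 0))).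

Definition pPlace := Seq pInsert (If (eCO 1) Skip pNewClass).

Definition pPartition :=
  Seq (For 12 0 (Put 2 (EConst 0) (EVar 12) (EConst 1)))
    (For 1 0 (Seq pLoopTest (If (EVar 7) pPlace Skip))).

Section Partition.
Variables (V : finType) (M : matroid V).
Implicit Types (s : state) (col : V -> nat) (u v w x : V) (d k r : nat).
Local Notation run := (run (indep M)).
Local Notation n := #|V|.

Definition lst1 r : V -> pred nat := fun _ d => 1 < d < r + 2.

Lemma lst1_bound r v d : r <= n -> lst1 r v d -> 0 < d < n + 2.
Proof. by rewrite /lst1; lia. Qed.

(** A coloring with exactly r colors, shifted by 2 past the reserved classes 0 and 1, would respect
    the lists and contradict [blocked_uncolorable]. *)
Lemma colorable_unblocked col x R k r :
  colorable (indep M) k -> valid M (lst1 r) col ->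
  blocked M (lst1 r) x col R -> col x = 0 -> r != k.
Proof.
case/existsP=> f /forallP fi vc bR cx; apply/eqP=> rE.
apply: (@blocked_uncolorable _ M (lst1 r) x _ col R (fun v =>
  f v + 2) (r + 2) vc bR cx).
- by move=> v d /andP[]; lia.
- by move=> v; rewrite rE ltn_add2r.
- by move=> v; rewrite /lst1 rE ltn_add2r ltn_ord; lia.
move=> d; have [->|[v]] := set_0Vmem (cls (fun v => f v + 2) d);
  first exact: indep0.
rewrite inE => /eqP vd; apply: indep_sub (fi (f v)); apply/subsetP=> u.
by rewrite !inE -vd eqn_add2r.
Qed.

Lemma pNewClassP s col x r :
  scalar s 0 = n -> scalar s 1 = rk x -> scalar s 9 = r -> r < n -> rep s col ->
  replst (lst1 r) s -> valid M (lst1 r) col -> indep M [set x] -> col x = 0 ->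
  let s' := run pNewClass s in
  [/\ scalar s' 9 = r.+1, rep s' (upd col x r.+2), replst (lst1 r.+1) s'
    & valid M (lst1 r.+1) (upd col x r.+2)].
Proof.
move=> s0 s1 s9 rn rp rl [vl vi] ix cx s';
  rewrite {}/s' /pNewClass run_seq run_seq.
set sA := run (Assign _ _) s; set sB := run (pSet _ _) sA.
have A9 : scalar sA 9 = r.+1 by rewrite /sA run_assign /= s9 addn1.
have rB : rep sB (upd col x r.+2).
  by apply: rep_pSet => // t ft; rewrite /= ft A9 addn1.
have B9 : scalar sB 9 = r.+1 by rewrite run_scalar.
split; first by rewrite run_scalar.
- by apply: rep_ext rB => a i j; rewrite !inE => /orP[]/eqP ->;
  rewrite run_array.
- have B0 : scalar sB 0 = n by rewrite run_scalar // run_scalar.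
  pose Inv j s' := forall v d, d < n + 2 -> (array s' 3 (rk v) d != 0) =
     if d == r.+2 then rk v < j else lst1 r v d.
  have : Inv (scalar sB 0 +
    0) (run (For 12 0 (Put 3 (EVar 12) (EAdd (EVar 9) (EConst 1)) (EConst 1)))
      sB).
    apply: run_for.
      move=> v d dn; rewrite -[array _ _ _ _]/(array s 3 (rk v) d) rl //.
      by case: eqP => // ->; rewrite /lst1; lia.
    move=> j t jn tj ft _ It v d dn; rewrite run_put /= tj ft // B9 addn1.
    case: (eqVneq d r.+2) => [->|dr]; last by rewrite andbF It // (negbTE dr).
    by rewrite andbT ltnS leq_eqVlt; case: (eqVneq (rk v) j) => //= _;
      rewrite It ?eqxx; lia.
  move=> It v d dn; rewrite It // B0 addn0 rk_lt /lst1; case: eqP => [->|]; lia.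
split=> [v|d d0].
  rewrite /upd; case: (eqVneq v x) => [_ _|_ /vl]; rewrite /lst1; lia.
have [->|dr] := eqVneq d r.+2.
  rewrite cls_upd_new (_ : cls col r.+2 = set0) ?setU0 //.
  apply/setP=> v; rewrite !inE; apply/negbTE/eqP=> vr.
  by have := vl v; rewrite vr /lst1; lia.
have [dx|dx] := eqVneq d (col x); last by rewrite cls_upd_other ?vi.
by rewrite dx cx in d0.
Qed.

Definition partitioned j r s col :=
  [/\ scalar s 9 = r, rep s col, replst (lst1 r) s, valid M (lst1 r) col
    & (forall v, (col v != 0) = (rk v < j) && indep M [set v])].

Lemma pPartitionP s :
  scalar s 0 = n -> (forall y, y != 0 -> scalar s y = 0) ->
  (forall a i j, a != 0 -> array s a i j = 0) ->
  exists r col, [/\ partitioned n r (run pPartition s) col, r <= n &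
    forall k, colorable (indep M) k -> r <= k].
Proof.
move=> s0 sz az; rewrite /pPartition run_seq.
set sA := run (For 12 _ _) s.
have A0 : scalar sA 0 = n by rewrite run_scalar.
have rA : rep sA (fun _ : V => 0).
  move=> v; split; first by rewrite run_array // az.
  have : forall v d, array sA 2 d (rk v) = (rk v < scalar s 0 + 0) && (0 == d).
    pose Inv j s' := forall v d, array s' 2 d (rk v) =
      (rk v < j) && (0 == d) :> nat.
    apply: (@run_for _ _ Inv) => [u d|j t jn tj _ _ It u d];
      first by rewrite /= az.
    rewrite run_put /= tj ltnS leq_eqVlt (eq_sym d).
    by rewrite It; case: (0 == d); case: (rk u == j); case: (rk u < j).
  by move=> H d; rewrite H s0 addn0 rk_lt.
pose Inv j s' := (exists r col, [/\ partitioned j r s' col, r <= j &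
    forall k, colorable (indep M) k -> r <= k]) /\
  forall v, array s' 6 0 (rk v) = 0.
have : Inv (scalar sA 0 +
  0) (run (For 1 0 (Seq pLoopTest (If (EVar 7) pPlace Skip))) sA).
  apply: run_for.
    split; last by move=> v; rewrite /= run_array // az.
    exists 0, (fun _ : V => 0); split=> //; split=> //.
    - by rewrite /= run_scalar // sz.
    - by move=> v d _; rewrite /= run_array // az // /lst1; lia.
    - split=> // d d0; rewrite (_ : cls _ d = set0) ?indep0 //.
      by apply/setP=> v; rewrite !inE; case: d d0.
  move=> j t; rewrite A0 addn0 =>
    jn tj ft fa [[r [col [[t9 rt rl vc dm] rj rmin]]] z6].
  have [x xj] := rk_ex jn; rewrite -xj in tj.
  have t0 : scalar t 0 = n by rewrite ft.
  rewrite run_seq run_if.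
  have q7 : scalar (run pLoopTest t) 7 = indep M [set x].
    rewrite /=; congr (nat_of_bool (indep M _)); apply/setP=> v.
    by rewrite !inE /= tj rk_eq z6; case: (v == x).
  have z6' v : array (run pLoopTest t) 6 0 (rk v) = 0.
    by rewrite /= tj rk_eq z6; case: (v == x).
  have u0 : scalar (run pLoopTest t) 0 = n by rewrite run_scalar.
  have u1 : scalar (run pLoopTest t) 1 = rk x by rewrite run_scalar.
  have u9 : scalar (run pLoopTest t) 9 = r by rewrite run_scalar.
  have ru : rep (run pLoopTest t) col.
    by apply: rep_ext rt => a i i'; rewrite !inE => /orP[]/eqP ->;
      rewrite run_array.
  have rlu : replst (lst1 r) (run pLoopTest t) by move=> v d dn;
    rewrite run_array; auto.
  move: (run pLoopTest t) q7 z6' u0 u1 u9 ru rlu => u q7 z6' u0 u1 u9 ru rlu.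
  rewrite [eval _ _]/= q7; case: (boolP (indep M [set x])) => /= ix; last first.
    split; last exact: z6'.
    exists r, col; split=> //; last exact: leqW.
    split=> // v; rewrite dm ltnS [in RHS]leq_eqVlt;
      case: (eqVneq (rk v) j) => //= vj.
    have -> : v = x by apply/eqP; rewrite -rk_eq vj xj.
    by rewrite (negbTE ix) andbF.
  split; last by move=> v; rewrite /= run_array.
  have cx : col x = 0 by apply/eqP; rewrite -[_ == _]negbK dm xj ltnn.
  rewrite /pPlace run_seq run_if.
  have lb v d : lst1 r v d -> 0 < d < n + 2 by apply: lst1_bound; lia.
  have [col' [r' v' dm' bl]] := pInsertP lb u0 u1 ru rlu vc cx.
  have w0 : scalar (run pInsert u) 0 = n by rewrite run_scalar.
  have w1 : scalar (run pInsert u) 1 = rk x by rewrite run_scalar.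
  have w9 : scalar (run pInsert u) 9 = r by rewrite run_scalar.
  have rlw : replst (lst1 r) (run pInsert u) by move=> v d dn;
    rewrite run_array; auto.
  move: (run pInsert u) r' w0 w1 w9 rlw => w r' w0 w1 w9 rlw.
  have dmS col2 : col2 x != 0 -> (forall v, v != x ->
    (col2 v == 0) = (col v == 0)) ->
      forall v, (col2 v != 0) = (rk v < j.+1) && indep M [set v].
    move=> c2x c2 v; case: (eqVneq v x) => [->|vx].
      by rewrite c2x xj ltnSn ix.
    rewrite c2 // dm ltnS [in RHS]leq_eqVlt; case: eqP => //= vj.
    by move: vx; rewrite -rk_eq vj xj eqxx.
  rewrite (rep_co r' w1); have [x0|x0] := eqVneq (col' x) 0; last first.
    exists r, col'; split=> //; last exact: leqW.
    by split=> //; apply: dmS.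
  have [R bR] := bl x0.
  have [w9' rw rlw' vw] :=
    pNewClassP w0 w1 w9 (leq_ltn_trans rj jn) r' rlw v' ix x0.
  exists r.+1, (upd col' x r.+2); split=> //.
    split=> //; apply: dmS; first by rewrite /upd eqxx.
    by move=> v vx; rewrite /upd (negbTE vx) dm'.
  (* r was at most k so far, and the failed insertion excludes equality; so r + 1 is still at most
     k. *)
  move=> k ck; rewrite ltn_neqAle rmin // andbT.
  exact: colorable_unblocked ck v' bR x0.
by rewrite A0 addn0 => -[].
Qed.

End Partition.

(** * Extracting stable independent sets *)

Definition eMark x := EGet 7 (EConst 0) (EVar x).
Definition eC k := EAdd (EVar 10) (EConst k).

Definition pMarkOne :=
  Seq (Put 7 (EConst 0) (EVar 1) (EConst 1))
    (Seq (Put 3 (EVar 1) (eC 2) (EConst 0))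
       (Seq (Put 3 (EVar 1) (EConst 1) (EConst 1))
          (Seq (Put 3 (EVar 1) (eC 1) (EConst 1)) (pSet 1 (EConst 0))))).

Definition pLists :=
  For 5 2 (Put 3 (EVar 1) (EVar 5) (eAnd (EVar 5) (EEq (eCO 1) (EVar 5)))).

Definition pMark :=
  For 1 0 (Seq pLists
    (If (EEq (eCO 1) (eC 2)) pMarkOne (Put 7 (EConst 0) (EVar 1) (EConst 0)))).

Definition pSplit := For 1 0 (If (eMark 1) pInsert Skip).

Definition gNbr :=
  eAnd (EGet 0 (EVar 1) (EVar 13))
    (eAnd (EEq (eCO 13) (EConst 1)) (eNot (eMark 13))).

Definition pNbr :=
  Seq (Assign 14 (EConst 0)) (For 13 0 (If gNbr (Assign 14 (EConst 1)) Skip)).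

(** A candidate that is accepted loses its mark, and a rejected one leaves class 1. Hence the
    unmarked vertices of class 1 are always the current I. *)
Definition pCommit :=
  For 1 0 (If (eAnd (eMark 1) (EEq (eCO 1) (EConst 1)))
    (Seq pNbr (If (EVar 14) (pSet 1 (eC 2)) (Put 7 (EConst 0) (EVar 1) (EConst
      0))))
    Skip).

Definition pStage := Seq pMark (Seq pSplit pCommit).

Definition pOutput :=
  For 1 0 (If (EEq (eCO 1) (EConst 1))
    (Seq (Put 1 (EVar 1) (EConst 0) (EVar 11)) (pSet 1 (EConst 0))) Skip).

Definition pRound :=
  Seq (Assign 11 (EAdd (EVar 11) (EConst 1))) (Seq (For 10 0 pStage) pOutput).

(** A [For] gives about |V| iterations; doubling its body yields the 2|V| rounds. *)
Definition pMain := Seq pPartition (For 15 0 (Seq pRound pRound)).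

(** * One stage: marking, splitting and committing *)

Section Rounds.
Variables (V : finType) (M : matroid V) (G : sgraph V).
Implicit Types (s t : state) (col : V -> nat) (u v w x y : V) (c d k r : nat).
Local Notation run := (run (indep M)).
Local Notation n := #|V|.

Definition repadj s := forall u v, (array s 0 (rk u) (rk v) != 0) = adj G u v.
Definition mark s v := array s 7 0 (rk v).

(** Stages count from 0: I is class 1, U_c is class c + 1 and J_(c+1) is class c + 2. For c = 0 the
    two choices offered to J_1 coincide. *)
Definition lst2 col c : V -> pred nat := fun v d =>
  if col v == c.+2 then (d == 1) || (d == c.+1) else (0 < d) && (col v == d).

Definition unplace col c : V -> nat :=
  fun v => if col v == c.+2 then 0 else col v.

Lemma pMarkP s col c :
  scalar s 0 = n -> scalar s 10 = c -> c < n -> rep s col ->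
  [/\ rep (run pMark s) (unplace col c), replst (lst2 col c) (run pMark s)
    & forall v, mark (run pMark s) v = (col v == c.+2)].
Proof.
move=> s0 s10 cn r.
pose Inv j s' :=
  [/\ rep s' (fun v => if rk v < j then unplace col c v else col v),
      forall v d, rk v < j -> d < n + 2 ->
        (array s' 3 (rk v) d != 0) = lst2 col c v d
    & forall v, rk v < j -> mark s' v = (col v == c.+2)].
have : Inv (scalar s 0 + 0) (run pMark s).
  apply: run_for; first by split.
  move=> j t; rewrite s0 addn0 => jn tj ft fa [rt lt mt].
  have [x xj] := rk_ex jn; rewrite -xj in tj.
  have t0 : scalar t 0 = n by rewrite ft.
  have t10 : scalar t 10 = c by rewrite ft.
  have xE v : (rk v == j) = (v == x) by rewrite -xj rk_eq.
  rewrite run_seq run_if.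
  have : forall v d, (array (run pLists t) 3 (rk v) d != 0) =
      if (v == x) && (d < scalar t 0 + 2) then (0 < d) && (col x == d)
      else array t 3 (rk v) d != 0.
    pose J k t' := forall v d, (array t' 3 (rk v) d != 0) =
      if (v == x) && (d < k) then (0 < d) && (col x == d)
      else array t 3 (rk v) d != 0.
    apply: (@run_for _ _ J); first by move=> v d; rewrite andbF.
    move=> k t' kn t'5 ft' fa' IH v d; rewrite run_put.
    have : (eval t' (eAnd (EVar 5) (EEq (eCO 1) (EVar 5))) != 0) =
      (0 < k) && (col x == k).
      rewrite eval_and /= t'5 ft' // tj fa' // (rt x).1 xj ltnn lt0n.
      by rewrite eqb0 negbK.
    move: (eval t' (eAnd _ _)) => e ev; rewrite /= t'5 ft' // tj rk_eq.
    case: (eqVneq v x) => [vx|vx] /=; last by rewrite IH (negbTE vx).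
    rewrite ltnS leq_eqVlt; case: (eqVneq d k) => [->|dk] /=; last first.
      by rewrite IH vx eqxx.
    exact: ev.
  rewrite t0 => l1.
  have r1 : rep (run pLists t) (fun v =>
    if rk v < j then unplace col c v else col v).
    by apply: rep_ext rt => a i i'; rewrite !inE => /orP[]/eqP ->;
      rewrite run_array.
  have m1 v : mark (run pLists t) v = mark t v by rewrite /mark run_array.
  have a1 : scalar (run pLists t) 1 = rk x by rewrite run_scalar.
  have a10 : scalar (run pLists t) 10 = c by rewrite run_scalar.
  move: (run pLists t) l1 r1 m1 a1 a10 => t1 l1 r1 m1 a1 a10.
  have ltS v : v != x -> (rk v < j.+1) = (rk v < j).
    by move=> vx; rewrite ltnS leq_eqVlt xE (negbTE vx).
  rewrite /= a1 (r1 x).1 a10 addn2 xj ltnn eqb0 negbK.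
  case: (boolP (col x == c.+2)) => [/eqP xc|xc].
    rewrite /pMarkOne 4!run_seq; set t2 := run (Put 3 _ (eC 1) _) _.
    have t2E : t2 = set_array (set_array (set_array (set_array t1 7 0 (rk x) 1)
        3 (rk x) c.+2 0) 3 (rk x) 1 1) 3 (rk x) c.+1 1.
      by rewrite /t2 !run_put /= a1 a10 addn1 addn2.
    have t21 : scalar t2 1 = rk x by rewrite t2E.
    have rt2 : rep t2 (fun v => if rk v < j then unplace col c v else col v).
      by apply: rep_ext r1 => a i i'; rewrite t2E !inE => /orP[]/eqP ->.
    have r3 := rep_pSet M rt2 t21 (e := EConst 0) (k := 0) (fun _ _ => erefl).
    split.
    - move=> v; have [r31 r32] := r3 v; rewrite /upd in r31 r32.
      have -> : (if rk v < j.+1 then unplace col c v else col v) =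
          (if v == x then 0 else if rk v < j then unplace col c v else col v).
        case: (eqVneq v x) => [->|vx]; last by rewrite ltS.
        by rewrite xj ltnSn /unplace xc eqxx.
      by split.
    - move=> v d vj dn; rewrite [array _ _ _ _]run_array // t2E /= !rk_eq.
      case: (eqVneq v x) => [->|vx] /=.
        rewrite /lst2 xc eqxx; case: (eqVneq d c.+1) => d1;
          first by rewrite orbT.
        case: (eqVneq d 1) => d2 //=.
        case: (eqVneq d c.+2) => //= d3.
        by rewrite l1 eqxx dn xc eq_sym (negbTE d3) andbF.
      by rewrite l1 (negbTE vx); apply: lt => //; rewrite -ltS.
    - move=> v vj; rewrite /mark [array _ _ _ _]run_array // t2E /= rk_eq.
      case: (eqVneq v x) => [->|vx] /=; first by rewrite xc eqxx.
      by rewrite -/(mark t1 v) m1 mt // -ltS.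
  split.
  - apply: (@rep_ext _ _ t1) => [a i i'|];
    first by rewrite !inE => /orP[]/eqP ->.
    move=> v; have [r11 r12] := r1 v.
    have -> : (if rk v < j.+1 then unplace col c v else col v) =
          (if rk v < j then unplace col c v else col v).
      case: (eqVneq v x) => [->|vx]; last by rewrite ltS.
      by rewrite xj ltnSn ltnn /unplace (negbTE xc).
    by split.
  - move=> v d vj dn; rewrite [array _ _ _ _]/= l1 dn andbT.
    case: (eqVneq v x) => [->|vx]; last by apply: lt => //; rewrite -ltS.
    by rewrite /lst2 (negbTE xc).
  - move=> v vj; rewrite /mark run_put /= a1 rk_eq.
    case: (eqVneq v x) => [->|vx] /=; first by rewrite (negbTE xc).
    by rewrite -/(mark t1 v) m1 mt // -ltS.
rewrite s0 addn0 => -[i1 i2 i3]; split=> [v|v d dn|v].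
- by have := i1 v; rewrite rk_lt.
- by rewrite i2 ?rk_lt.
- by rewrite i3 ?rk_lt.
Qed.

(** Condition on entering stage c. In stage 0 the classes of I and U_0 coincide; this class must be
    empty to take in all of J_1. *)
Definition good c col :=
  [/\ forall d, 0 < d -> indep M (cls col d),
      indep M (cls col 1 :|: cls col c.+1), stable G (cls col 1),
      c = 0 -> cls col 1 = set0 & forall v, col v < n + 2].

Lemma split_not_blocked col col' c x R :
  c < n -> good c col -> valid M (lst2 col c) col' ->
  blocked M (lst2 col c) x col' R -> col x = c.+2 -> col' x = 0 -> False.
Proof.
move=> cn [gi gU _ g0 _] vc bR xc x0; have xR := blocked_root bR.
have xJ : x \in cls col c.+2 by rewrite inE xc.
have sub d : 0 < d -> cls col' d \subset cls col d :|: cls col c.+2.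
  move=> d0; apply/subsetP=> v; rewrite !inE => /eqP vd.
  have := vc.1 v; rewrite vd -lt0n d0 => /(_ isT).
  by rewrite /lst2; case: (eqVneq (col v) c.+2) => [_|_ /andP[_ ->]];
    rewrite ?orbT.
have lJ v d : v \in cls col c.+2 -> (d == 1) || (d == c.+1) -> lst2 col c v d.
  by rewrite /lst2 inE => ->.
have l0 v d : lst2 col c v d -> 0 < d.
  by rewrite /lst2; case: ifP => _; [case/orP=> /eqP ->|case/andP].
have lA v d : 0 < d -> (d == 1) || (d == c.+1) ->
    v \in cls col d :|: cls col c.+2 -> lst2 col c v d.
  move=> d0 d1; rewrite in_setU => /orP[vd|vJ]; last exact: lJ.
  rewrite /lst2; case: ifP => // _; rewrite d0.
  by move: vd; rewrite inE.
(* The exchange argument needs two distinct classes. For c = 0 class 1 starts empty, and one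
   application of [blocked_card] to J_1 suffices. *)
have [c0|c0] := posnP c; last first.
  apply: (@exchange_not_blocked _ M (lst2 col c) x col' R (cls col 1)
    (cls col c.+1) (cls col c.+2) 1 c.+1) => //.
  - exact: gi.
  - exact: sub.
  - exact: sub.
  - by rewrite eqSS eq_sym -lt0n.
  - by move=> v; apply: lA.
  - by move=> v; apply: lA => //; rewrite eqxx orbT.
have : #|cls col c.+2 :&: R| <= #|cls col' 1 :&: R|.
  apply: blocked_card vc bR _ (subsetIr _ _) _ _ => //.
    by apply: indep_sub (subsetIl _ _) (gi _ _).
  by move=> v; rewrite inE => /andP[vJ _]; apply: lJ.
have : cls col' 1 :&: R \subset (cls col c.+2 :&: R) :\ x.
  rewrite subsetD1; apply/andP; split; last by rewrite !inE x0.
  apply: setSI; apply: subset_trans (sub 1 isT) _.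
  by rewrite g0 // set0U.
move/subset_leq_card; rewrite [#|cls col c.+2 :&: R|](cardsD1 x) inE xJ xR.
by lia.
Qed.

Lemma pSplitP s col c :
  scalar s 0 = n -> c < n -> good c col -> rep s (unplace col c) ->
  replst (lst2 col c) s -> (forall v, mark s v = (col v == c.+2)) ->
  exists col', [/\ rep (run pSplit s) col', valid M (lst2 col c) col'
    & forall v, (col' v == 0) = (col v == 0)].
Proof.
move=> s0 cn gc r rl ms; have [gi gU _ g0 gn] := gc.
have lb v d : lst2 col c v d -> 0 < d < n + 2.
  rewrite /lst2; case: ifP => _; first by case/orP=> /eqP ->; lia.
  by case/andP=> -> /eqP <-; apply: gn.
pose Inv j s' := exists col', [/\ rep s' col', valid M (lst2 col c) col'
    & forall v, (col' v == 0) =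
        if col v == c.+2 then ~~ (rk v < j) else col v == 0].
have : Inv (scalar s 0 + 0) (run pSplit s).
  apply: run_for.
    exists (unplace col c); split=> //.
      split=> [v|d d0].
        rewrite /unplace /lst2; case: ifP => // _ v0.
        by rewrite lt0n v0 /=.
      apply: indep_sub (gi d d0); apply/subsetP=> v; rewrite !inE /unplace.
      by case: ifP => // _ /eqP d0'; rewrite -d0' in d0.
    by move=> v; rewrite /unplace; case: ifP.
  move=> j t; rewrite s0 addn0 => jn tj ft fa [col' [rt vt dt]].
  have [x xj] := rk_ex jn; rewrite -xj in tj.
  have t0 : scalar t 0 = n by rewrite ft.
  have rlt : replst (lst2 col c) t by move=> v d dn; rewrite fa // rl.
  have mx : eval t (eMark 1) = (col x == c.+2) by rewrite /= tj fa // -ms.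
  have ltS v : v != x -> (rk v < j.+1) = (rk v < j).
    by move=> vx; rewrite ltnS leq_eqVlt -xj rk_eq (negbTE vx).
  rewrite run_if mx eqb0 negbK; case: (boolP (col x == c.+2)) => xc; last first.
    exists col'; split=> // v; rewrite dt; case: ifP => // vc.
    by rewrite ltS //; apply: contraNneq xc => <-.
  have x0 : col' x = 0 by apply/eqP; rewrite dt xc xj ltnn.
  have [col2 [r2 v2 d2 b2]] := pInsertP lb t0 tj rt rlt vt x0.
  exists col2; split=> // v.
  case: (eqVneq v x) => [->|vx]; last by rewrite d2 // dt ltS.
  rewrite xc xj ltnSn /=; apply/negbTE/eqP=> x20.
  have [R bR] := b2 x20.
  exact: split_not_blocked cn gc v2 bR (eqP xc) x20.
rewrite s0 addn0 => -[col' [r' v' d']]; exists col'; split=> // v.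
by rewrite d' rk_lt; case: eqP => // ->.
Qed.

Lemma pNbrP s col x :
  scalar s 0 = n -> scalar s 1 = rk x -> rep s col -> repadj s ->
  (scalar (run pNbr s) 14 != 0) =
  [exists y, [&& adj G x y, col y == 1 & mark s y == 0]].
Proof.
move=> s0 s1 r ra; rewrite /pNbr run_seq.
set sA := run (Assign _ _) s.
pose Inv j s' := (scalar s' 14 != 0) =
  [exists y, [&& rk y < j, adj G x y, col y == 1 & mark s y == 0]].
have : Inv (scalar sA 0 +
  0) (run (For 13 0 (If gNbr (Assign 14 (EConst 1)) Skip)) sA).
  apply: run_for; first by rewrite /Inv /=; apply/esym/existsP => -[].
  move=> j t; rewrite [scalar sA 0]/= s0 addn0 => jn tj ft fa It.
  have [y yj] := rk_ex jn; rewrite -yj in tj.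
  rewrite run_if; have -> : (eval t gNbr != 0) =
      [&& adj G x y, col y == 1 & mark s y == 0].
    rewrite /gNbr !eval_and eval_not /= tj ft // -[scalar sA 1]/(scalar s 1) s1.
    by rewrite !fa // ra (r y).1 eqb0 negbK.
  rewrite /Inv; case: (boolP [&& adj G x y, _ & _]) => yP.
    by apply/esym/existsP; exists y; rewrite yj ltnSn yP.
  rewrite [LHS]It; apply/existsP/existsP=> -[z /andP[zj zP]]; exists z;
    rewrite zP andbT.
    exact: ltnW.
  rewrite ltn_neqAle -ltnS zj andbT; apply: contra yP => /eqP zjE.
  by rewrite (_ : y = z) //; apply/eqP; rewrite -rk_eq zjE yj.
rewrite /Inv => ->; apply: eq_existsb => y.
by rewrite [scalar sA 0]/= s0 addn0 rk_lt.
Qed.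

Lemma stableP (S : {set V}) :
  reflect {in S &, forall u v, ~~ adj G u v} (stable G S).
Proof.
apply: (iffP forall_inP) => [H u v uS vS|H u uS].
  by have /forall_inP := H u uS; apply.
by apply/forall_inP=> v; apply: H.
Qed.

Lemma pCommitP s col col1 c :
  scalar s 0 = n -> scalar s 10 = c -> rep s col1 -> repadj s ->
  (forall v, mark s v = (col v == c.+2)) ->
  (forall v, col v != c.+2 -> col1 v = col v) -> stable G (cls col 1) ->
  exists col', [/\ rep (run pCommit s) col', stable G (cls col' 1)
   & forall v, col' v = col1 v \/
      [/\ col v = c.+2, col1 v = 1, col' v =
        c.+2 & exists2 y, adj G v y & col' y = 1]].
Proof.
move=> s0 s10 r ra ms c1 st.
(* Class 1 as a whole need not be stable before the loop ends, so stability is claimed for the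
   committed part. *)
pose settled t col' := [set v | (col' v == 1) && (mark t v == 0)].
pose Inv j t := exists col', [/\ rep t col',
   forall v, rk v >= j -> col' v = col1 v /\ mark t v = (col v == c.+2),
   forall v, rk v < j -> col' v = 1 -> mark t v = 0,
   stable G (settled t col')
   & forall v, col' v = col1 v \/
      [/\ col v = c.+2, col1 v = 1, col' v = c.+2
        & exists2 y, adj G v y & y \in settled t col']].
have : Inv (scalar s 0 + 0) (run pCommit s).
  apply: run_for.
    exists col1; split=> //; [by move=> v _; split; [|exact: ms]| |by left].
    apply/stableP=> u v; rewrite !inE => /andP[/eqP u1 mu] /andP[/eqP v1 mv].
    have E w : col1 w = 1 -> mark (set_scalar s 1 0) w == 0 -> w \in cls col 1.
      by move=> w1; rewrite -[mark _ w]/(mark s w) ms eqb0 => /c1;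
        rewrite inE => <-; apply/eqP.
    by apply: (stableP _ st); apply: E.
  move=> j t; rewrite s0 addn0 => jn tj ft fa [col' [rt ge lt sst tr]].
  have [x xj] := rk_ex jn; rewrite -xj in tj.
  have [cx mx] : col' x = col1 x /\ mark t x = (col x == c.+2) by apply: ge;
    rewrite xj.
  have t0 : scalar t 0 = n by rewrite ft.
  have rat : repadj t by move=> u v; rewrite fa.
  have ltE v : (rk v < j.+1) = (v == x) || (rk v < j).
    by rewrite ltnS leq_eqVlt -xj rk_eq.
  have geE v : j < rk v -> v != x by move=> vj; rewrite -rk_eq xj gtn_eqF.
  rewrite run_if eval_and.
  have -> : (eval t (eMark 1) != 0) = (col x == c.+2).
    by rewrite /= tj -/(mark t x) mx eqb0 negbK.
  have -> : (eval t (EEq (eCO 1) (EConst 1)) != 0) = (col1 x == 1).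
    by rewrite /= tj (rt x).1 cx eqb0 negbK.
  case: (boolP (_ && _)) => [/andP[/eqP xc /eqP x1]|nb]; last first.
    exists col'; split=> //.
    - by move=> v vj; apply: ge; apply: ltnW.
    - move=> v; rewrite ltE => /orP[/eqP ->|/lt //]; rewrite cx => x1 /=.
      by rewrite -[RHS]/(nat_of_bool false) -[LHS]/(mark t x) mx; move: nb;
        rewrite x1 andbT => /negbTE ->.
  have := pNbrP t0 tj rt rat.
  have u10 : scalar (run pNbr t) 10 = c by rewrite run_scalar // ft.
  have u1 : scalar (run pNbr t) 1 = rk x by rewrite run_scalar.
  have ru : rep (run pNbr t) col' by apply: rep_ext rt => a i i' _;
    rewrite run_array.
  have mu v : mark (run pNbr t) v = mark t v by rewrite /mark run_array.
  rewrite run_seq; move: (run pNbr t) u10 u1 ru mu => u u10 u1 ru mu u14.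
  rewrite run_if -[eval u (EVar 14)]/(scalar u 14) u14.
  have ru' : rep (run (pSet 1 (eC 2)) u) (upd col' x c.+2).
    by apply: rep_pSet => // w fw; rewrite /= fw u10 addn2.
  have x1' : col' x = 1 by rewrite cx.
  case: (boolP [exists y, _]) => [/existsP[y /and3P[xy y1 my]]|noy].
    have mw v : mark (set_scalar (run (pSet 1 (eC 2)) u) 1 j.+1) v = mark t v.
      by rewrite -mu /mark [array _ _ _ _]run_array.
    have sE : settled (set_scalar (run (pSet 1 (eC 2)) u) 1 j.+1) (upd col' x
      c.+2) = settled t col'.
      apply/setP=> v; rewrite !inE mw /upd; case: (eqVneq v x) => [->|//].
      by rewrite mx xc eqxx /= andbF.
    exists (upd col' x c.+2); rewrite sE; split=> //.
    - move=> v vj; rewrite mw /upd (negbTE (geE v vj)).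
      by apply: ge; apply: ltnW.
    - move=> v; rewrite ltE mw /upd; case: (eqVneq v x) => [//|_] /=.
      exact: lt.
    - move=> v; rewrite /upd; case: (eqVneq v x) => [->|_]; last exact: tr.
      by right; split=> //; exists y => //; rewrite inE y1.
  set w := run _ u.
  have mw v : mark (set_scalar w 1 j.+1) v = if v == x then 0 else mark t v.
    by rewrite /w run_put /mark /= u1 rk_eq -/(mark u v) mu.
  have rw : rep (set_scalar w 1 j.+1) col'.
    by apply: rep_ext ru => a i i'; rewrite !inE /w run_put => /orP[]/eqP ->.
  have sE : settled (set_scalar w 1 j.+1) col' = x |: settled t col'.
    apply/setP=> v; rewrite !inE mw; case: (eqVneq v x) => [->|//].
    by rewrite x1'.
  have nox y : y \in settled t col' -> ~~ adj G x y.
    rewrite inE => /andP[y1 my]; apply: contra noy => xy.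
    by apply/existsP; exists y; rewrite xy y1.
  exists col'; rewrite sE; split=> //.
  - move=> v vj; rewrite mw (negbTE (geE v vj)).
    by apply: ge; apply: ltnW.
  - by move=> v; rewrite ltE mw; case: (eqVneq v x) => //= _; apply: lt.
  - apply/stableP=> v v' /setU1P[->|vS] /setU1P[->|vS'].
    + by rewrite adj_irr.
    + exact: nox.
    + by rewrite adj_sym nox.
    + exact: (stableP _ sst).
  - move=> v; case: (tr v) => [|[vc v1 v2 [y vy yS]]]; first by left.
    by right; split=> //; exists y => //; rewrite in_setU1 yS orbT.
rewrite s0 addn0 => -[col' [r' _ m0 st' tr]]; exists col'; split=> //.
  apply/stableP=> u v; rewrite !inE => /eqP u1 /eqP v1.
  by apply: (stableP _ st'); rewrite inE ?u1 ?v1 /= m0 // rk_lt.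
move=> v; case: (tr v) => [|[vc v1 v2 [y vy yS]]]; [by left|right].
by split=> //; exists y => //; move: yS; rewrite inE => /andP[/eqP].
Qed.

Lemma pStageP s col c :
  scalar s 0 = n -> scalar s 10 = c -> c < n -> rep s col -> repadj s ->
  good c col ->
  exists col', [/\ rep (run pStage s) col', good c.+1 col',
    forall v, col v != c.+2 -> col' v = col v
  & forall v, col v = c.+2 -> [\/ col' v = 1, col' v = c.+1 |
       col' v = c.+2 /\ exists2 y, adj G v y & col' y = 1]].
Proof.
move=> s0 s10 cn r ra gc; rewrite /pStage run_seq run_seq.
have [r1 l1 m1] := pMarkP s0 s10 cn r.
have a0 : scalar (run pMark s) 0 = n by rewrite run_scalar.
have a10 : scalar (run pMark s) 10 = c by rewrite run_scalar.
have aa : repadj (run pMark s) by move=> u v; rewrite run_array.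
move: (run pMark s) r1 l1 m1 a0 a10 aa => t r1 l1 m1 a0 a10 aa.
have [col1 [r2 [vl vi] d2]] := pSplitP a0 cn gc r1 l1 m1.
have b0 : scalar (run pSplit t) 0 = n by rewrite run_scalar.
have b10 : scalar (run pSplit t) 10 = c by rewrite run_scalar.
have ba : repadj (run pSplit t) by move=> u v; rewrite run_array.
have m2 v : mark (run pSplit t) v =
  (col v == c.+2) by rewrite -m1 /mark run_array.
move: (run pSplit t) r2 b0 b10 ba m2 => w r2 b0 b10 ba m2.
have cE v : col v != c.+2 -> col1 v = col v.
  move=> vc; have [v0|v0] := eqVneq (col v) 0.
    by apply/eqP; rewrite v0 d2 v0.
  have := vl v; rewrite d2 v0 => /(_ isT).
  by rewrite /lst2 (negbTE vc) => /andP[_ /eqP].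
have cJ v : col v = c.+2 -> col1 v = 1 \/ col1 v = c.+1.
  move=> vc; have := vl v; rewrite d2 vc => /(_ isT).
  by rewrite /lst2 vc eqxx => /orP[]/eqP; [left|right].
case: gc => gi _ st _ gn.
have [col' [r3 st3 tr]] := pCommitP b0 b10 r2 ba m2 cE st.
have c1n v : col1 v != c.+2.
  have [vc|vc] := eqVneq (col v) c.+2; last by rewrite cE.
  by case: (cJ v vc) => ->; lia.
have sub d : d != c.+2 -> cls col' d \subset cls col1 d.
  move=> dc; apply/subsetP=> v; rewrite !inE => /eqP vd.
  case: (tr v) => [<-|[_ _ v2 _]]; first by rewrite vd.
  by rewrite -vd v2 eqxx in dc.
(* U_(c+1) consists of rejected members of P, so together with the new I it lies in the independent
   set I u P, which is class 1 before the commit. *)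
have sub2 : cls col' c.+2 \subset cls col1 1.
  apply/subsetP=> v; rewrite !inE => /eqP vd.
  case: (tr v) => [v1|[_ -> //]].
  by move: (c1n v); rewrite -v1 vd eqxx.
exists col'; split=> //.
- split=> //.
  + move=> d d0; have [->|dc] := eqVneq d c.+2.
      exact: indep_sub sub2 (vi 1 isT).
    exact: indep_sub (sub d dc) (vi d d0).
  + apply: indep_sub (vi 1 isT); rewrite subUset sub2 andbT.
    by apply: sub; rewrite eqSS.
  + move=> v; case: (tr v) => [->|[_ _ -> _]]; last by lia.
    have [vc|vc] := eqVneq (col v) c.+2; last by rewrite cE.
    by case: (cJ v vc) => ->; lia.
- move=> v vc; case: (tr v) => [->|[vc']]; first exact: cE.
  by rewrite vc' eqxx in vc.
move=> v vc; case: (tr v) => [->|[_ _ v2 H]]; last by constructor 3.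
by case: (cJ v vc) => ->; [constructor 1|constructor 2].
Qed.

End Rounds.

(** * One round, its potential, and the whole algorithm *)

Section Main.
Variables (V : finType) (M : matroid V) (G : sgraph V).
Implicit Types (s t : state) (col : V -> nat) (u v w x y : V) (c d k r : nat).
Local Notation run := (run (indep M)).
Local Notation n := #|V|.
Local Notation repadj := (repadj G).

(** The four possible fates of a vertex in a round. The last two are those of a vertex that remains,
    and each lowers its potential. *)
Variant round_step (col0 col : V -> nat) v : Prop :=
| StepFree of col0 v = 0 & col v = 0
| StepOut of 0 < col0 v & col v = 1
| StepDown of 0 < col v & col0 v = (col v).+1
| StepBlocked y of 0 < col0 v & col v = col0 v & adj G v y & col y = 1.

Lemma stagesP s col0 :
  scalar s 0 = n -> rep s col0 -> repadj s ->
  (forall d, 0 < d -> indep M (cls col0 d)) -> (forall v, col0 v != 1) ->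
  (forall v, col0 v < n + 2) ->
  exists col, [/\ rep (run (For 10 0 pStage) s) col,
    forall d, 0 < d -> indep M (cls col d), stable G (cls col 1),
    forall v, col v < n + 2 & forall v, round_step col0 col v].
Proof.
move=> s0 r ra gi g1 gn.
(* Stage c settles exactly the vertices that began the round in class c + 2. Later stages never
   remove a vertex from class 1, so a blocking neighbor stays valid. *)
pose Inv c t := exists col, [/\ rep t col, good M G c col,
  forall v, c.+1 < col0 v -> col v = col0 v
  & forall v, col0 v <= c.+1 -> round_step col0 col v].
have cls1 : cls col0 1 = set0.
  by apply/setP=> v; rewrite !inE (negbTE (g1 v)).
have : Inv (scalar s 0 + 0) (run (For 10 0 pStage) s).
  apply: run_for.
    exists col0; split=> //.
      split=> //; first by rewrite cls1 setU0 indep0.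
      by rewrite cls1; apply/stableP => u v; rewrite inE.
    by move=> v v1; have v0 : col0 v = 0; [have := g1 v; lia|constructor 1].
  move=> c t; rewrite s0 addn0 => cn tc ft fa [col [rt gc hi lo]].
  have t0 : scalar t 0 = n by rewrite ft.
  have ta : repadj t by move=> u v; rewrite fa.
  have [col' [r' g' k' j']] := pStageP t0 tc cn rt ta gc.
  have one y : col y = 1 -> col' y = 1 by move=> y1; rewrite k' y1.
  have loc v : col0 v <= c.+1 -> col v != c.+2.
    by move=> vc; case: (lo v vc) => *; lia.
  exists col'; split=> // v vc.
    by rewrite k' hi //; lia.
  have [vc'|vc'] := leqP (col0 v) c.+1.
    have e := k' v (loc v vc');
      case: (lo v vc') => [v0 v1|v0 v1|v0 v1|y v0 v1 vy y1].
    - by constructor 1; rewrite ?e.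
    - by constructor 2; rewrite ?e.
    - by constructor 3; rewrite ?e.
    - by apply: (StepBlocked (y := y)); rewrite ?e // one.
  have v2 : col v = c.+2 by rewrite hi //; lia.
  have v0 : col0 v = c.+2 by lia.
  case: (j' v v2) => [v1|v1|[v1 [y vy y1]]].
  - by constructor 2; rewrite // v0.
  - by constructor 3; rewrite v1.
  - by apply: (StepBlocked (y := y)); rewrite ?v0.
rewrite s0 addn0 => -[col [r' [i' _ st' _ n'] _ lo]]; exists col; split=> // v.
by apply: lo; have := gn v; lia.
Qed.

Definition out s v := array s 1 (rk v) 0.

Lemma pOutputP s col :
  scalar s 0 = n -> rep s col ->
  rep (run pOutput s) (fun v => if col v == 1 then 0 else col v) /\
  forall v, out (run pOutput s) v = if col v == 1 then scalar s 11 else out s v.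
Proof.
move=> s0 r; pose Inv j t :=
  rep t (fun v => if (rk v < j) && (col v == 1) then 0 else col v) /\
  forall v, out t v = if (rk v <
    j) && (col v == 1) then scalar s 11 else out s v.
have : Inv (scalar s 0 + 0) (run pOutput s).
  apply: run_for; first by split.
  move=> j t; rewrite s0 addn0 => jn tj ft fa [rt ot].
  have [x xj] := rk_ex jn; rewrite -xj in tj.
  have ltE v : (rk v < j.+1) = (v == x) || (rk v < j).
    by rewrite ltnS leq_eqVlt -xj rk_eq.
  rewrite run_if.
  have -> : (eval t (EEq (eCO 1) (EConst 1)) != 0) = (col x == 1).
    by rewrite /= tj (rt x).1 xj ltnn eqb0 negbK.
  case: (boolP (col x == 1)) => x1; last first.
    split=> v; rewrite ltE; case: (eqVneq v x) => [->|_] /=.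
    - by have := rt x; rewrite xj ltnn (negbTE x1).
    - exact: rt.
    - by rewrite -[LHS]/(out t x) ot xj ltnn (negbTE x1).
    - exact: ot.
  rewrite run_seq; set t1 := run (Put _ _ _ _) t.
  have t1E : t1 = set_array t 1 (rk x) 0 (scalar s 11).
    by rewrite /t1 run_put /= tj ft.
  have r1 : rep t1 (fun v => if (rk v < j) && (col v == 1) then 0 else col v).
    by apply: rep_ext rt => a i i'; rewrite t1E !inE => /orP[]/eqP ->.
  have t11 : scalar t1 1 = rk x by rewrite t1E.
  have r2 := rep_pSet M r1 t11 (e := EConst 0) (k := 0) (fun _ _ => erefl).
  split=> v; rewrite ltE.
    have := r2 v; rewrite /upd; case: (eqVneq v x) => [->|//].
    by rewrite x1.
  rewrite -[LHS]/(array (run (pSet 1 (EConst 0)) t1) 1 (rk v) 0) run_array //.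
  rewrite t1E /= rk_eq andbT; case: (eqVneq v x) => [->|vx] /=;
    first by rewrite x1.
  exact: ot.
rewrite s0 addn0 => -[r1 o1]; split=> v; last by rewrite o1 rk_lt.
by have := r1 v; rewrite rk_lt.
Qed.

Definition live_degree col v := #|[set u | adj G v u & col u != 0]|.

(* The class index of a vertex plus its number of uncolored
   neighbours drops by one in every round, whence the bound K on the colors. *)
Definition after_round K i s := exists col,
  [/\ rep s col, (forall d, 0 < d -> indep M (cls col d)),
      (forall v, col v != 1 /\ col v < n + 2),
      (forall v, 0 < col v -> (col v).-1 + live_degree col v + i <= K)
    & [/\ scalar s 11 = i,
      (forall v, (0 < col v) || (0 < out s v) = indep M [set v]),
      (forall v, 0 < col v -> out s v = 0),
      (forall v, out s v <= K /\ out s v <= i)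
    & (forall j, 0 < j -> graph_cap_matroid G M [set v | out s v == j])]].

Lemma pRoundP K i s :
  scalar s 0 = n -> repadj s -> after_round K i s ->
  after_round K i.+1 (run pRound s).
Proof.
move=> s0 ra [col0 [r gi gn gd [s11 cov z0 ob oc]]];
  rewrite /pRound run_seq run_seq.
set sA := run (Assign _ _) s.
have A0 : scalar sA 0 = n by rewrite run_scalar.
have A11 : scalar sA 11 = i.+1 by rewrite /sA run_assign /= s11 addn1.
have Aa : repadj sA by move=> u v; rewrite run_array.
have Ar : rep sA col0 by apply: rep_ext r => a j k _; rewrite run_array.
have Ao v : out sA v = out s v by rewrite /out run_array.
move: sA A0 A11 Aa Ar Ao => t t0 t11 ta rt to.
have [|v|col1 [r1 i1 st1 n1 tr]] := stagesP t0 rt ta gi.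
- by move=> v; case: (gn v).
- by case: (gn v).
set sB := run (For 10 0 pStage) t in r1 *.
have B0 : scalar sB 0 = n by rewrite run_scalar.
have B11 : scalar sB 11 = i.+1 by rewrite run_scalar.
have Bo v : out sB v = out s v by rewrite -to /out run_array.
move: sB B0 B11 Bo r1 => w w0 w11 wo r1.
have [r2 o2] := pOutputP w0 r1.
set col2 := fun v => if col1 v == 1 then 0 else col1 v in r2.
have q11 : scalar (run pOutput w) 11 = i.+1 by rewrite run_scalar.
move: (run pOutput w) r2 o2 q11 => q r2 o2 q11.
have oE v : out q v = if col1 v == 1 then i.+1 else out s v by rewrite o2 w11
  wo.
have pos0 v : 0 < col1 v -> 0 < col0 v.
  by case: (tr v) => [_ ->|//|_ ->|].
have live2 v : 0 < col2 v -> 0 < col1 v by rewrite /col2; case: eqP.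
have sub2 v : [set u | adj G v u & col2 u != 0] \subset [set u | adj G v u &
  col0 u != 0].
  apply/subsetP=> u; rewrite !inE -!lt0n => /andP[-> u2].
  exact/pos0/live2.
exists col2; split=> //.
- move=> d d0; apply: indep_sub (i1 d d0); apply/subsetP=> v.
  rewrite !inE /col2; case: ifP => // _ /eqP d0'.
  by rewrite -d0' in d0.
- move=> v; rewrite /col2; case: ifP => [_|/negbT c1]; last by split.
  by split=> //; lia.
- move=> v v2; have v1 := live2 v v2.
  have c1 : col1 v != 1 by move: v2; rewrite /col2; case: ifP.
  have e2 : col2 v = col1 v by rewrite /col2 (negbTE c1).
  have := gd v (pos0 v v1); have := subset_leq_card (sub2 v).
  rewrite -/(live_degree col2 v) -/(live_degree col0 v) e2.
  case: (tr v) => [_|_|_ ->|y v0 cv vy y1]; try lia.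
  (* The blocking neighbor y was uncolored at the start of the round and receives its color now. *)
  have : live_degree col2 v < live_degree col0 v.
    apply: proper_card; apply/properP; split=> //; exists y.
      by rewrite inE vy -lt0n pos0 ?y1.
    by rewrite inE vy /col2 y1.
  by rewrite cv; lia.
have out0 v : col1 v == 1 -> out s v = 0.
  by move=> /eqP v1; apply: z0; apply: pos0; rewrite v1.
split=> //.
- move=> v; rewrite oE /col2 -cov; case: (eqVneq (col1 v) 1) => [v1|v1].
    by rewrite pos0 ?v1.
  by case: (tr v) => *; lia.
- move=> v v2; rewrite oE; have := v2; rewrite /col2; case: ifP => // _ v1.
  by apply: z0; apply: pos0.
- move=> v; rewrite oE; case: ifP => [v1|_]; last by have [? ?] := ob v;
  split=> //; lia.
  (* A vertex present before the round has class at least 2, so its potential leaves room for color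
     i + 1 below K. *)
  have v0 : 0 < col0 v by apply: pos0; rewrite (eqP v1).
  by have := gd v v0; have [] := gn v; split=> //; lia.
move=> j j0; have [ji|ji] := eqVneq j i.+1.
  rewrite (_ : [set v | _] = cls col1 1).
    by rewrite /graph_cap_matroid st1 i1.
  apply/setP=> v; rewrite !inE oE ji; case: ifP; first by rewrite eqxx.
  by move=> _; have [_] := ob v; lia.
rewrite (_ : [set v | _] = [set v | out s v == j]); first exact: oc.
apply/setP=> v; rewrite !inE oE; case: ifP => // v1.
by rewrite out0 // eq_sym (negbTE ji) eq_sym gtn_eqF.
Qed.

(** Stated without assuming that M is colorable: loops keep output 0, and all other vertices receive
    positive colors. *)
Lemma pMainP :
  exists r, (forall k, colorable (indep M) k -> r <= k) /\
  (forall v, out (run pMain (input G)) v <= max_degree G + r) /\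
  (forall j, 0 < j ->
     graph_cap_matroid G M [set v | out (run pMain (input G)) v == j]) /\
  (forall v, indep M [set v] -> 0 < out (run pMain (input G)) v).
Proof.
set s := input G.
have sa : repadj s.
  move=> u v; rewrite /s /=; set b := [exists _, _].
  have -> : b = adj G u v by apply/existsP/idP => [[u' /existsP[v']]|uv];
    [rewrite !val_eqE !(inj_eq enum_rank_inj) => /and3P[/eqP -> /eqP ->]
    |exists u; apply/existsP; exists v; rewrite !eqxx].
  by case: (adj G u v).
have [|||r [col [pc rn rmin]]] := @pPartitionP V M s.
- by [].
- by move=> y; rewrite /s /=; case: (y == 0).
- by move=> a i j; rewrite /s /=; case: (a == 0).
exists r; split=> //; set K := max_degree G + r.
rewrite /pMain run_seq; set t := run pPartition s in pc *.
have t0 : scalar t 0 = n by rewrite run_scalar.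
have ta : repadj t by move=> u v; rewrite run_array.
have tout v : out t v = 0 by rewrite /out run_array.
have t11 : scalar t 11 = 0 by rewrite run_scalar.
have I0 : after_round K 0 t.
  case: pc => _ rt _ [vl vi] dm; exists col; split=> //.
  - move=> v; have [v0|v0] := eqVneq (col v) 0; first by rewrite v0;
    split=> //; lia.
    by have := vl v v0; rewrite /lst1; split; lia.
  - move=> v v0; rewrite addn0 addnC leq_add //.
      apply: leq_trans (leq_bigmax v); apply: subset_leq_card.
      by apply/subsetP=> u; rewrite !inE => /andP[].
    by have := vl v; rewrite -lt0n v0 /lst1 => /(_ isT); lia.
  split=> //.
  - by move=> v; rewrite tout orbF lt0n dm rk_lt.
  - by move=> v; rewrite tout.
  move=> j j0; rewrite (_ : [set v | _] = set0).
    rewrite /graph_cap_matroid indep0 andbT.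
    by apply/stableP => u v; rewrite inE.
  by apply/setP=> v; rewrite !inE tout eq_sym gtn_eqF.
have : after_round K (scalar t 0 + 0).*2 (run (For 15 0 (Seq pRound pRound)) t).
  apply: (@run_for _ _ (fun j => after_round K j.*2)); first exact: I0.
  move=> j u jn uj fu fa H.
  have u0 : scalar u 0 = n by rewrite fu.
  have ua : repadj u by move=> v w; rewrite fa.
  have v0 : scalar (run pRound u) 0 = n by rewrite run_scalar.
  have va : repadj (run pRound u) by move=> v w; rewrite run_array.
  have [col2 ?] := pRoundP v0 va (pRoundP u0 ua H).
  by exists col2.
rewrite t0 addn0 => -[col2 [_ _ cn cd [_ cov _ ob oc]]]; split; last split=> //.
  by move=> v; case: (ob v).
move=> v vi; have := cov v; rewrite vi; case: posnP => //= v0.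
have := cd v v0; have [v1 _] := cn v.
(* After 2n rounds a remaining vertex would have potential at least 1 + 2n, but K is at most 2n. *)
have : max_degree G <= n by apply/bigmax_leqP => u _; apply: max_card.
by rewrite /K; lia.
Qed.

End Main.

Theorem theorem2p8 :
  exists (c : cmd) (p : {poly nat}),
  forall (V : finType) (M : matroid V) (G : sgraph V),
  exists (t : nat) (s : state),
    [/\ exec (indep M) c (input G) t s,
        t <= (p.[#|V|])%R
      & forall (Delta : nat) (colM : exists k, colorable (indep M) k),
          max_degree G <= Delta ->
          coloring (graph_cap_matroid G M) (output s) /\
          num_colors (output (V := V) s) <= Delta + chi colM + 1].
Proof.
exists (compile pMain), (cost pMain) => V M G.
have [|||t tp et] := @exec_compile V (indep M) pMain (input G) => //.
exists t, (run (indep M) pMain (input G)); split=> // Delta colM dD.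
have [r [rmin [ob [oc opos]]]] := pMainP M G.
have rchi : r <= chi colM by rewrite /chi; case: ex_minnP => k kc _;
  apply: rmin.
(* A colorable matroid has no loop, so no vertex keeps the default output 0. *)
have out_pos (v : V) : 0 < out (run (indep M) pMain (input G)) v.
  apply: opos; case: colM {rchi} => k /existsP[f /forallP fi].
  by apply: indep_sub (fi (f v)); rewrite sub1set inE.
split.
  move=> c; have [->|c0] := posnP c; last exact: oc.
  rewrite (_ : [set v | _] = set0).
    rewrite /graph_cap_matroid indep0 andbT.
    by apply/stableP => u v; rewrite inE.
  apply/setP=> v; rewrite !inE; apply/negbTE; rewrite -lt0n; exact: out_pos.
(* All colors used lie between 1 and Delta + r, which is within the stated bound with one color to
   spare. *)
have /leq_trans : num_colors (output (V :=
  V) (run (indep M) pMain (input G))) <= size (iota 1 (max_degree G + r)).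
  apply: uniq_leq_size; first exact: undup_uniq.
  move=> j; rewrite mem_undup => /mapP[v _ ->].
  by rewrite mem_iota add1n ltnS ob out_pos.
by apply; rewrite size_iota; lia.
Qed.
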